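(* Let $({}_{f_2}M_1\times{}_{f_1}M_2,F)$ be a doubly warped product Finsler manifold. Then $(TM^\circ,\mathbf{G},\mathbf{J})$ is a Kählerian manifold if and only if the doubly warped horizontal distribution $HTM^\circ$ is integrable.
   Context: A Finsler metric on a manifold $M$ is a function $F:TM\to[0,\infty)$ that is $C^\infty$ on the slit tangent bundle $TM^\circ$, positively $1$-homogeneous on fibres, and whose fibre Hessian of $\frac12F^2$ is positive definite. Let $(M_1,F_1)$, $(M_2,F_2)$ be Finsler manifolds and let $f_1:M_1\to\mathbb{R}^+$, $f_2:M_2\to\mathbb{R}^+$ be smooth. The doubly warped product Finsler manifold $({}_{f_2}M_1\times{}_{f_1}M_2,F)$ is $M=M_1\times M_2$ with $$F(v_1,v_2)=\sqrt{f_2^2(\pi_2(v_2))F_1^2(v_1)+f_1^2(\pi_1(v_1))F_2^2(v_2)},\qquad (v_1,v_2)\in TM^\circ:=TM_1^\circ\times TM_2^\circ,$$ where $\pi_1,\pi_2$ are the base-point projections. In induced coordinates $(\mathbf{x}^a,\mathbf{y}^a)$ on $TM$ put $\mathbf{g}_{ab}=\frac12\frac{\partial^2F^2}{\partial\mathbf{y}^a\partial\mathbf{y}^b}$ with inverse $\mathbf{g}^{ab}$, $\mathbf{G}^a=\frac14\mathbf{g}^{ab}\big(\frac{\partial^2F^2}{\partial\mathbf{y}^b\partial\mathbf{x}^c}\mathbf{y}^c-\frac{\partial F^2}{\partial\mathbf{x}^b}\big)$, $\mathbf{G}^a_b=\frac{\partial\mathbf{G}^a}{\partial\mathbf{y}^b}$,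 $\frac{\delta^d}{\delta^d\mathbf{x}^a}=\frac{\partial}{\partial\mathbf{x}^a}-\mathbf{G}^b_a\frac{\partial}{\partial\mathbf{y}^b}$, $\delta^d\mathbf{y}^a=d\mathbf{y}^a+\mathbf{G}^a_b\,d\mathbf{x}^b$ (the superscript $d$ is a label). The doubly warped horizontal distribution is $HTM^\circ=\mathrm{span}\{\frac{\delta^d}{\delta^d\mathbf{x}^a}\}\subset TTM^\circ$. The doubly warped Sasaki–Matsumoto metric is the Riemannian metric $\mathbf{G}=\mathbf{g}_{ab}\,d\mathbf{x}^a\otimes d\mathbf{x}^b+\mathbf{g}_{ab}\,\delta^d\mathbf{y}^a\otimes\delta^d\mathbf{y}^b$ on $TM^\circ$. The almost complex structure $\mathbf{J}$ on $TM^\circ$ is defined by $\mathbf{J}\big(\frac{\delta^d}{\delta^d\mathbf{x}^a}\big)=-\frac{\partial}{\partial\mathbf{y}^a}$, $\mathbf{J}\big(\frac{\partial}{\partial\mathbf{y}^a}\big)=\frac{\delta^d}{\delta^d\mathbf{x}^a}$. Kählerian means: $\mathbf{G}(\mathbf{J}X,\mathbf{J}Y)=\mathbf{G}(X,Y)$ for all $X,Y$, the $2$-form $\Omega(X,Y)=\mathbf{G}(X,\mathbf{J}Y)$ is closed, and $\mathbf{J}$ is integrable, i.e. its Nijenhuis tensor $N_{\mathbf{J}}(X,Y)=[\mathbf{J}X,\mathbf{J}Y]-\mathbf{J}[\mathbf{J}X,Y]-\mathbf{J}[X,\mathbf{J}Y]-[X,Y]$ vanishes. *)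

(* Defs.v *)
From HB Require Import structures.
From mathcomp Require Import all_boot all_order all_algebra.
From mathcomp Require Import all_classical all_reals all_analysis.
Set Implicit Arguments.
Unset Strict Implicit.
Unset Printing Implicit Defensive.
Import Order.TTheory GRing.Theory Num.Theory.
Import numFieldNormedType.Exports.
Local Open Scope classical_set_scope.
Local Open Scope ring_scope.

(* Only meant for U open.  In finite dimension this is the usual C^k: Frechet
   differentiability together with C^(k-1) directional derivatives. *)
Fixpoint Ck_on (R : realType) (V W : normedModType R) (k : nat)
    (U : set V) (f : V -> W) : Prop :=
  if k is k'.+1 then
    (forall x, U x -> differentiable f x) /\
    (forall v : V, Ck_on k' U (fun x => 'D_v f x))
  else forall x, U x -> {for x, continuous f}.

Definition smooth_on (R : realType) (V W : normedModType R)
    (U : set V) (f : V -> W) : Prop :=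
  forall k, Ck_on k U f.

(* A homeomorphism from the open set cdom onto the open set cimg of R^n; cmap
   and cinv are total, and their values outside these sets are irrelevant. *)
Record chart (R : realType) (n : nat) (M : topologicalType) := Chart {
  cdom : set M;
  cimg : set 'rV[R]_n;
  cmap : M -> 'rV[R]_n;
  cinv : 'rV[R]_n -> M;
  cdom_open : open cdom;
  cimg_open : open cimg;
  cmap_img : forall p, cdom p -> cimg (cmap p);
  cinv_dom : forall x, cimg x -> cdom (cinv x);
  cmapK : forall p, cdom p -> cinv (cmap p) = p;
  cinvK : forall x, cimg x -> cmap (cinv x) = x;
  cmap_continuous : forall p, cdom p -> {for p, continuous cmap};
  cinv_continuous : forall x, cimg x -> {for x, continuous cinv}
}.

(* chart_at chooses a chart around each point; it serves to realise T_pM as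
   R^n, see TM. *)
Record manifold (R : realType) (n : nat) := Manifold {
  carrier :> topologicalType;
  manifold_hausdorff : hausdorff_space carrier;
  manifold_second_countable : @second_countable carrier;
  atlas : set (chart R n carrier);
  chart_at : carrier -> chart R n carrier;
  chart_at_atlas : forall p, atlas (chart_at p);
  chart_at_dom : forall p, cdom (chart_at p) p;
  transition_smooth : forall c d, atlas c -> atlas d ->
    smooth_on (cimg c `&` cinv c @^-1` cdom d) (cmap d \o cinv c)
}.

Definition smooth_fun (R : realType) (n : nat) (M : manifold R n)
    (f : M -> R) : Prop :=
  forall c, atlas c -> smooth_on (cimg c) (f \o cinv c).

(* (p, v) is the tangent vector at p whose components in the coordinates of
   chart_at p are v. *)
Definition TM (R : realType) (n : nat) (M : manifold R n) : Type :=
  (M * 'rV[R]_n)%type.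

(* The tangent vector with induced coordinates z = (x, y) in the chart c: the
   components y are carried from c to chart_at p by the differential of the
   transition map. *)
Definition tangent_of_coord (R : realType) (n : nat) (M : manifold R n)
    (c : chart R n M) (z : 'rV[R]_n * 'rV[R]_n) : TM M :=
  let: (x, y) := z in
  let p := cinv c x in (p, 'd (cmap (chart_at p) \o cinv c) x y).

Definition slit_coord (R : realType) (n : nat) (M : manifold R n)
    (c : chart R n M) : set ('rV[R]_n * 'rV[R]_n) :=
  [set z | cimg c z.1 /\ z.2 != 0].

Record finsler (R : realType) (n : nat) (M : manifold R n)
    (F : TM M -> R) : Prop := Finsler {
  finsler_ge0 : forall v : TM M, 0 <= F v;
  finsler_smooth : forall c, atlas c ->
    smooth_on (slit_coord c) (F \o tangent_of_coord c);
  finsler_homogeneous : forall (p : M) (v : 'rV[R]_n) (l : R), 0 < l ->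
    F (p, l *: v) = l * F (p, v);
  finsler_posdef : forall (p : M) (v u : 'rV[R]_n), v != 0 -> u != 0 ->
    0 < 'D_u (fun v' => 'D_u (fun w => F (p, w) ^+ 2 / 2) v') v
}.

(* Tensor calculus on an open subset D of a normed space V, each tangent space
   of D being identified with V. *)
Section LocalCalculus.
Context {R : realType} {V : normedModType R}.
Implicit Types (D W : set V) (X Y : V -> V).

Definition lie_bracket X Y : V -> V :=
  fun z => 'D_(X z) Y z - 'D_(Y z) X z.

(* The exterior derivative of om evaluated on constant vector fields. *)
Definition closed_2form D (om : V -> V -> V -> R) : Prop :=
  forall z, D z -> forall u v w : V,
    'D_u (fun z' => om z' v w) z - 'D_v (fun z' => om z' u w) z
      + 'D_w (fun z' => om z' u v) z = 0.

Definition nijenhuis (J : V -> V -> V) X Y : V -> V :=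
  let JX := fun z => J z (X z) in
  let JY := fun z => J z (Y z) in
  fun z => lie_bracket JX JY z - J z (lie_bracket JX Y z)
           - J z (lie_bracket X JY z) - lie_bracket X Y z.

Definition kahlerian_on D (G : V -> V -> V -> R) (J : V -> V -> V) : Prop :=
  [/\ forall z, D z -> forall u v, G z (J z u) (J z v) = G z u v,
      closed_2form D (fun z u v => G z u (J z v))
    & forall W X Y, open W -> W `<=` D -> smooth_on W X -> smooth_on W Y ->
        forall z, W z -> nijenhuis J X Y z = 0].

(* A distribution is integrable when the bracket of any two of its local
   smooth sections is again a section. *)
Definition integrable_on D (H : V -> set V) : Prop :=
  forall W X Y, open W -> W `<=` D -> smooth_on W X -> smooth_on W Y ->
    (forall z, W z -> H z (X z)) -> (forall z, W z -> H z (Y z)) ->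
    forall z, W z -> H z (lie_bracket X Y z).

End LocalCalculus.

(* Objects attached to a function F of the induced coordinates z = (x, y).  A
   tangent vector X at z is written (X.1, X.2), i.e. it is
   X.1 0 a d/dx^a + X.2 0 a d/dy^a. *)
Section InducedCoordinates.
Context {R : realType} {N : nat}.
Local Notation Z := ('rV[R]_N * 'rV[R]_N)%type.
Variable F : Z -> R.

Definition ddx (a : 'I_N) : Z := (delta_mx 0 a, 0).
Definition ddy (a : 'I_N) : Z := (0, delta_mx 0 a).

Definition Fsq (z : Z) : R := F z ^+ 2.

Definition fund_tensor (z : Z) : 'M[R]_N :=
  \matrix_(a, b) (2^-1 * 'D_(ddy a) (fun z' => 'D_(ddy b) Fsq z') z).

Definition spray_coef (a : 'I_N) (z : Z) : R :=
  4^-1 * \sum_b invmx (fund_tensor z) a b *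
    (\sum_c 'D_(ddy b) (fun z' => 'D_(ddx c) Fsq z') z * z.2 0 c
     - 'D_(ddx b) Fsq z).

Definition nonlin_conn (a b : 'I_N) (z : Z) : R := 'D_(ddy b) (spray_coef a) z.

Definition delta_x (a : 'I_N) (z : Z) : Z :=
  ddx a - \sum_b nonlin_conn b a z *: ddy b.

Definition delta_y (a : 'I_N) (z X : Z) : R :=
  X.2 0 a + \sum_b nonlin_conn a b z * X.1 0 b.

Definition horizontal (z : Z) : set Z :=
  [set X | exists h : 'rV[R]_N, X = \sum_a h 0 a *: delta_x a z].

Definition sasaki_matsumoto (z X Y : Z) : R :=
  \sum_a \sum_b fund_tensor z a b * (X.1 0 a * Y.1 0 b)
  + \sum_a \sum_b fund_tensor z a b * (delta_y a z X * delta_y b z Y).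

(* dx^a and delta_y a being dual to delta_x a and ddy a, this is the linear
   map determined by its values on that frame; see the two lemmas below. *)
Definition Jmap (z X : Z) : Z :=
  \sum_a (delta_y a z X *: delta_x a z - X.1 0 a *: ddy a).

Lemma delta_x1 a z : (delta_x a z).1 = delta_mx 0 a.
Proof.
rewrite /delta_x /= (raddf_sum (@fst _ _)) big1 ?subr0// => b _.
by rewrite /= scaler0.
Qed.

Lemma delta_y_delta_x a b z : delta_y a z (delta_x b z) = 0.
Proof.
rewrite /delta_y delta_x1 /delta_x /= (raddf_sum (@snd _ _)) /= sub0r.
move: nonlin_conn => k.
rewrite mxE summxE (bigD1 a)//= big1 => [|c /negPf ca]; last first.
  by rewrite [LHS]mxE mxE (eq_sym a) ca andbF mulr0.
rewrite [X in - (X + _)]mxE mxE !eqxx mulr1 addr0.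
rewrite (bigD1 b)//= big1 => [|c /negPf cb]; last by rewrite mxE cb mulr0.
by rewrite mxE !eqxx mulr1 addr0 addNr.
Qed.

Lemma delta_y_ddy a b z : delta_y a z (ddy b) = (a == b)%:R.
Proof.
rewrite /delta_y /= big1 => [|c _]; last by rewrite mxE mulr0.
by rewrite addr0 mxE eqxx.
Qed.

Lemma Jmap_delta_x a z : Jmap z (delta_x a z) = - ddy a.
Proof.
rewrite /Jmap (bigD1 a)// big1 => [|b /negPf ba].
  rewrite Monoid.mulm1 delta_y_delta_x delta_x1 mxE !eqxx mulr1n.
  by rewrite scale0r scale1r sub0r.
by rewrite delta_y_delta_x delta_x1 mxE ba andbF !scale0r subr0.
Qed.

Lemma Jmap_ddy a z : Jmap z (ddy a) = delta_x a z.
Proof.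
rewrite /Jmap (bigD1 a)// big1 => [|b /negPf ba].
  by rewrite Monoid.mulm1 delta_y_ddy mxE eqxx scale1r scale0r subr0.
by rewrite delta_y_ddy ba mxE !scale0r subr0.
Qed.

End InducedCoordinates.

Section DoublyWarped.
Context {R : realType} {n1 n2 : nat} {M1 : manifold R n1} {M2 : manifold R n2}.
Variables (F1 : TM M1 -> R) (F2 : TM M2 -> R) (f1 : M1 -> R) (f2 : M2 -> R).

Definition doubly_warped (v : TM M1 * TM M2) : R :=
  Num.sqrt (f2 v.2.1 ^+ 2 * F1 v.1 ^+ 2 + f1 v.1.1 ^+ 2 * F2 v.2 ^+ 2).

Local Notation Z := ('rV[R]_(n1 + n2) * 'rV[R]_(n1 + n2))%type.

(* The coordinates induced on T(M1 x M2) = TM1 x TM2 by a chart c1 of M1 and a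
   chart c2 of M2; dw_coord is their range over TM1 slit x TM2 slit. *)
Definition dw_coord (c1 : chart R n1 M1) (c2 : chart R n2 M2) : set Z :=
  [set z | slit_coord c1 (lsubmx z.1, lsubmx z.2) /\
           slit_coord c2 (rsubmx z.1, rsubmx z.2)].

Definition dw_local (c1 : chart R n1 M1) (c2 : chart R n2 M2) (z : Z) : R :=
  doubly_warped (tangent_of_coord c1 (lsubmx z.1, lsubmx z.2),
                 tangent_of_coord c2 (rsubmx z.1, rsubmx z.2)).

(* Tensors and distributions on the slit bundle are handled through their
   expressions in the induced coordinates; the conditions below are local and
   are required in all of these. *)
Definition dw_kahlerian : Prop :=
  forall c1 c2, atlas c1 -> atlas c2 ->
    kahlerian_on (dw_coord c1 c2)
      (sasaki_matsumoto (dw_local c1 c2)) (Jmap (dw_local c1 c2)).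

Definition dw_horizontal_integrable : Prop :=
  forall c1 c2, atlas c1 -> atlas c2 ->
    integrable_on (dw_coord c1 c2) (horizontal (dw_local c1 c2)).

End DoublyWarped.

(* Main.v *)
Require Import Defs.
From HB Require Import structures.
From mathcomp Require Import all_boot all_order all_algebra.
From mathcomp Require Import all_classical all_reals all_analysis.
From mathcomp Require Import ring.
Import Order.TTheory GRing.Theory Num.Theory.
Import numFieldNormedType.Exports.
Local Open Scope classical_set_scope.
Local Open Scope ring_scope.

(* Write E = F^2 and let N^a_b be the nonlinear connection.  Three facts hold
   whatever the integrability of HTM, because E is smooth with an invertible
   fibre Hessian:
   - J preserves G, because J exchanges the horizontal and vertical components;
   - the fundamental form is -d(1/2 dE/dy^a dx^a), since the definition of the
     spray yields g_ab N^b_c - g_cb N^b_a =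
     1/2 (d^2E/dx^c dy^a - d^2E/dx^a dy^c); hence it is closed;
   - in the adapted frame the Nijenhuis tensor only involves the curvature
     R^a_bc = (delta N^a_b/delta x^c) - (delta N^a_c/delta x^b), the vertical
     derivatives dN^a_b/dy^c = d^2G^a/dy^b dy^c cancelling by symmetry.
   As the vertical part of the bracket of two horizontal fields is R as well,
   being Kaehler and the integrability of HTM both mean R = 0.  For the doubly
   warped F the fibre Hessian of E is a sum of positive multiples of those of
   F1^2 and F2^2, transported by the invertible differentials of transition
   maps. *)

(** * Smooth functions on open sets *)

Section SmoothCalculus.
#[local] Set Implicit Arguments.
#[local] Unset Strict Implicit.
Context {R : realType}.
Implicit Types (V W : normedModType R).

(** The first-order expansion of [f] at [x] is also one of [g], because the two functions agree near
    [x] and at [x] itself; uniqueness of the differential concludes. *)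
Lemma near_eq_differentiable {V W} (f g : V -> W) (x : V) :
  {near x, f =1 g} -> differentiable f x -> differentiable g x.
Proof.
move=> fg df.
have dg : g \o shift x = cst (g x) + 'd f x +o_ 0 id.
  apply/eqaddoP => _/posnumP[e].
  have /eqaddoP /(_ e%:num) /(_ [gt0 of e%:num]) := diff_locally df.
  apply: filter_app.
  have : \forall z \near (0 : V), f (z + x) = g (z + x).
    rewrite (near_shift x) /= sub0r; near=> y.
    by rewrite /= subrK; near: y.
  apply: filterS => z fgz.
  by rewrite !fctE /= fgz (nbhs_singleton fg).
have cdf : continuous ('d f x) by exact: diff_continuous.
by apply/diff_locallyP; rewrite (diff_unique cdf dg); split.
Unshelve. all: by end_near. Qed.

Lemma open_near {V} (U : set V) (x : V) (P : V -> Prop) : open U -> U x ->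
  (forall y, U y -> P y) -> \forall y \near x, P y.
Proof. by move=> oU Ux UP; apply: filterS UP _; exact: open_nbhs_nbhs. Qed.

Lemma eq_on_derive {V W} (U : set V) (f g : V -> W) (x v : V) : open U -> U x ->
  (forall y, U y -> f y = g y) -> 'D_v f x = 'D_v g x.
Proof. by move=> oU Ux fg; apply/near_eq_derive/(open_near oU). Qed.

(** Since [U] is open, values on [U] determine all derivatives at points of [U], so the induction
    can pass from [f] to its directional derivatives. *)
Lemma Ck_on_ext {V W} k (U : set V) (f g : V -> W) : open U ->
  (forall x, U x -> f x = g x) -> Ck_on k U f -> Ck_on k U g.
Proof.
move=> oU; elim: k f g => [|k IH] f g fg /=.
  move=> cf x Ux; have fgx : g @ x --> f x; last by rewrite fg in fgx.
  apply: cvg_trans (cf x Ux).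
  by apply: near_eq_cvg; exact: (open_near oU).
move=> [df Df]; split=> [x Ux|v].
  by apply: near_eq_differentiable (df x Ux); exact: (open_near oU).
by apply: IH (Df v) => x Ux; exact: (eq_on_derive v oU Ux fg).
Qed.

Lemma Ck_on_continuous {V W} k (U : set V) (f : V -> W) x :
  Ck_on k U f -> U x -> {for x, continuous f}.
Proof.
case: k => [|k /= [df _]]; first by move=> Cf; exact: Cf.
by move=> Ux; exact/differentiable_continuous/df.
Qed.

Lemma Ck_onW {V W} k (U : set V) (f : V -> W) : Ck_on k.+1 U f -> Ck_on k U f.
Proof.
elim: k f => [|k IH] f Cf; first by move=> x; exact: Ck_on_continuous Cf.
by case: Cf => df Df; split=> // v; exact: IH.
Qed.

Lemma Ck_on_cst {V W} k (U : set V) (w : W) : Ck_on k U (fun _ : V => w).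
Proof.
elim: k w => [|k IH] w /=; first by move=> x _; exact: cst_continuous.
split=> [x _|v]; first exact: differentiable_cst.
have -> : (fun x : V => 'D_v (fun=> w) x) = fun=> 0; last exact: IH.
by apply/funext => x; rewrite derive_cst.
Qed.

Lemma Ck_onD {V W} k (U : set V) (f g : V -> W) : open U ->
  Ck_on k U f -> Ck_on k U g -> Ck_on k U (fun x => f x + g x).
Proof.
move=> oU; elim: k f g => [|k IH] f g.
  by move=> cf cg x Ux; apply: continuousD; [exact: cf|exact: cg].
move=> [df Df] [dg Dg]; split=> [x Ux|v].
  by apply: differentiableD; [exact: df|exact: dg].
apply: Ck_on_ext oU _ (IH _ _ (Df v) (Dg v)) => x Ux.
by rewrite -deriveD//; apply: diff_derivable; [exact: df|exact: dg].
Qed.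

Lemma Ck_onZl {V W} k (U : set V) (f : V -> R) (w : W) : open U ->
  Ck_on k U f -> Ck_on k U (fun x => f x *: w).
Proof.
move=> oU; elim: k f => [|k IH] f.
  by move=> cf x Ux; exact: (continuous_comp (cf x Ux) (@scalel_continuous _ _ w _)).
move=> [df Df]; split=> [x Ux|v].
  by apply: differentiableZl; exact: df.
apply: Ck_on_ext oU _ (IH _ (Df v)) => x Ux.
rewrite !deriveE//; [|exact: differentiableZl (df _ Ux)|exact: df].
by rewrite diffZl//; exact: df.
Qed.

(** In the derivative f Dg + g Df the undifferentiated factors are of class C^(k+1), which [Ck_onW]
    lowers to the C^k required by the induction. *)
Lemma Ck_onM {V} k (U : set V) (f g : V -> R) : open U ->
  Ck_on k U f -> Ck_on k U g -> Ck_on k U (fun x => f x * g x).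
Proof.
move=> oU; elim: k f g => [|k IH] f g.
  by move=> cf cg x Ux; apply: continuousM; [exact: cf|exact: cg].
move=> Cf Cg; have [df Df] := Cf; have [dg Dg] := Cg; split=> [x Ux|v].
  by apply: differentiableM; [exact: df|exact: dg].
apply: (Ck_on_ext oU); last first.
  by apply: Ck_onD => //; [exact: IH (Ck_onW Cf) (Dg v)|exact: IH (Ck_onW Cg) (Df v)].
by move=> x Ux; rewrite [RHS]deriveM//; apply: diff_derivable; [exact: df|exact: dg].
Qed.

(** The derivative of 1/f is -(1/f)(1/f)Df, and the induction hypothesis already makes 1/f of class
    C^k. *)
Lemma Ck_onV {V} k (U : set V) (f : V -> R) : open U ->
  (forall x, U x -> f x != 0) -> Ck_on k U f -> Ck_on k U (fun x => (f x)^-1).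
Proof.
move=> oU f0; elim: k => [|k IH].
  by move=> cf x Ux; apply: continuousV; [exact: f0|exact: cf].
move=> Cf; have [df Df] := Cf; split=> [x Ux|v].
  by apply: differentiableV; [exact: df|exact: f0].
have CV := IH (Ck_onW Cf).
have := Ck_onM oU (Ck_on_cst k U (-1 : R)) (Ck_onM oU (Ck_onM oU CV CV) (Df v)).
apply: Ck_on_ext oU _ => x Ux; rewrite deriveV ?f0//; last exact/diff_derivable/df.
by rewrite mulN1r -invfM -expr2 scaleNr.
Qed.

Lemma derive_comp_linear {V V' W} (l : {linear V -> V'}) (f : V' -> W) x v :
  'D_v (f \o l) x = 'D_(l v) f (l x).
Proof.
by rewrite /derive; do 2!f_equal; apply/funext => h /=; rewrite linearP.
Qed.

(** Differentiating [f \o l] along [v] gives the derivative of [f] along the fixed vector [l v],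
    again composed with [l]; the induction therefore never leaves compositions with [l]. *)
Lemma Ck_on_comp_linear {V V' W} k (U : set V') (l : {linear V -> V'})
    (f : V' -> W) : continuous l -> Ck_on k U f -> Ck_on k (l @^-1` U) (f \o l).
Proof.
move=> cl; elim: k f => [|k IH] f.
  by move=> cf x Ux; apply: continuous_comp; [exact: cl|exact: cf].
move=> [df Df]; split=> [x Ux|v].
  by apply: differentiable_comp; [exact: linear_differentiable|exact: df].
have -> : (fun x => 'D_v (f \o l) x) = (fun x => 'D_(l v) f x) \o l.
  by apply/funext => x; exact: derive_comp_linear.
exact: IH (Df (l v)).
Qed.

Lemma Ck_on_sub {V W} k (U U' : set V) (f : V -> W) : U' `<=` U ->
  Ck_on k U f -> Ck_on k U' f.
Proof.
move=> UU'; elim: k f => [|k IH] f; first by move=> cf x /UU'; exact: cf.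
by move=> [df Df]; split=> [x /UU'|v]; [exact: df|exact: IH (Df v)].
Qed.

Section SmoothOn.
Context {V W : normedModType R}.
Implicit Types (U : set V).

Lemma smooth_on_differentiable U (f : V -> W) x : smooth_on U f -> U x ->
  differentiable f x.
Proof. by move=> /(_ 1) [df _]; exact: df. Qed.

Lemma smooth_on_derivable U (f : V -> W) x v : smooth_on U f -> U x ->
  derivable f x v.
Proof. by move=> sf Ux; apply: diff_derivable; exact: smooth_on_differentiable sf Ux. Qed.

Lemma smooth_on_derive U (f : V -> W) v : smooth_on U f ->
  smooth_on U (fun x => 'D_v f x).
Proof. by move=> sf k; case: (sf k.+1) => _; apply. Qed.

Lemma smooth_on_ext U (f g : V -> W) : open U ->
  (forall x, U x -> f x = g x) -> smooth_on U f -> smooth_on U g.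
Proof. by move=> oU fg sf k; exact: (Ck_on_ext oU fg (sf k)). Qed.

Lemma smooth_on_cst U (w : W) : smooth_on U (fun _ => w).
Proof. by move=> k; exact: Ck_on_cst. Qed.

Lemma smooth_onD U (f g : V -> W) : open U ->
  smooth_on U f -> smooth_on U g -> smooth_on U (fun x => f x + g x).
Proof. by move=> oU sf sg k; exact: (Ck_onD oU (sf k) (sg k)). Qed.

Lemma smooth_on_sum U I (r : seq I) (P : pred I) (f : I -> V -> W) : open U ->
  (forall i, smooth_on U (f i)) ->
  smooth_on U (fun x => \sum_(i <- r | P i) f i x).
Proof.
move=> oU sf; elim: r => [|i r IH].
  by under eq_fun do rewrite big_nil; exact: smooth_on_cst.
under eq_fun do rewrite big_cons.
by case: (P i) => //; exact: smooth_onD.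
Qed.

Lemma smooth_onZl U (f : V -> R) (w : W) : open U ->
  smooth_on U f -> smooth_on U (fun x => f x *: w).
Proof. by move=> oU sf k; exact: (Ck_onZl w oU (sf k)). Qed.

End SmoothOn.

Section SmoothOnReal.
Context {V : normedModType R}.
Implicit Types (U : set V).

Lemma smooth_onM U (f g : V -> R) : open U ->
  smooth_on U f -> smooth_on U g -> smooth_on U (fun x => f x * g x).
Proof. by move=> oU sf sg k; exact: (Ck_onM oU (sf k) (sg k)). Qed.

Lemma smooth_onN U (f : V -> R) : open U ->
  smooth_on U f -> smooth_on U (fun x => - f x).
Proof.
move=> oU sf; apply: (@smooth_on_ext _ _ _ (fun x => -1 * f x)) => //.
  by move=> x _; rewrite mulN1r.
by apply: smooth_onM => //; exact: smooth_on_cst.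
Qed.

Lemma smooth_onV U (f : V -> R) : open U -> (forall x, U x -> f x != 0) ->
  smooth_on U f -> smooth_on U (fun x => (f x)^-1).
Proof. by move=> oU f0 sf k; exact: (Ck_onV oU f0 (sf k)). Qed.

Lemma smooth_on_prod U I (r : seq I) (P : pred I) (f : I -> V -> R) : open U ->
  (forall i, smooth_on U (f i)) ->
  smooth_on U (fun x => \prod_(i <- r | P i) f i x).
Proof.
move=> oU sf; elim: r => [|i r IH].
  by under eq_fun do rewrite big_nil; exact: smooth_on_cst.
under eq_fun do rewrite big_cons.
by case: (P i) => //; exact: smooth_onM.
Qed.

Lemma smooth_on_det U n (A : V -> 'M[R]_n) : open U ->
  (forall i j, smooth_on U (fun x => A x i j)) ->
  smooth_on U (fun x => \det (A x)).
Proof.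
move=> oU sA; apply: smooth_on_sum => // s.
apply: smooth_onM => //; first exact: smooth_on_cst.
by apply: smooth_on_prod => // i; exact: sA.
Qed.

(** Cramer's rule writes each entry of the inverse as a cofactor divided by the determinant, both
    polynomial in the entries of [A]. *)
Lemma smooth_on_invmx U n (A : V -> 'M[R]_n) : open U ->
  (forall x, U x -> A x \in unitmx) ->
  (forall i j, smooth_on U (fun x => A x i j)) ->
  forall i j, smooth_on U (fun x => invmx (A x) i j).
Proof.
move=> oU uA sA i j.
apply: (@smooth_on_ext _ _ _ (fun x => (\det (A x))^-1 * cofactor (A x) j i)) => //.
  by move=> x Ux; rewrite /invmx uA// !mxE.
apply: smooth_onM => //.
  by apply: smooth_onV; [|move=> x /uA; rewrite unitmxE unitfE|exact: smooth_on_det].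
apply: smooth_onM => //; first exact: smooth_on_cst.
apply: smooth_on_det => // k l.
by under eq_fun do rewrite !mxE; exact: sA.
Qed.

End SmoothOnReal.
End SmoothCalculus.

(** * Symmetry of second derivatives *)

Section Schwarz.
Context {R : realType} {V : normedModType R}.
#[local] Set Implicit Arguments.
#[local] Unset Strict Implicit.
Implicit Types (U : set V) (f : V -> R) (u v z : V).

Lemma is_derive_line f v z (t : R) : differentiable f (t *: v + z) ->
  is_derive t (1 : R) (fun s : R => f (s *: v + z)) ('D_v f (t *: v + z)).
Proof.
have E : (fun h : R => h^-1 *: (((fun s => f (s *: v + z)) \o shift t) (h *: 1) -
    f (t *: v + z))) =
  (fun h : R => h^-1 *: ((f \o shift (t *: v + z)) (h *: v) - f (t *: v + z))).
  by apply/funext => h /=; rewrite [h *: 1]mulr1 scalerDl addrA.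
move=> /(@diff_derivable _ _ _ _ _ v); rewrite /derivable -E => df.
by split; [exact: df|rewrite /derive E].
Qed.

(** The mean value theorem in one variable, applied to the restriction of [f] to the segment from
    [z] in the direction [v]. *)
Lemma MVT_line f v z (d : R) : 0 < d ->
  (forall t, 0 <= t <= d -> differentiable f (t *: v + z)) ->
  exists2 t, 0 <= t <= d & f (d *: v + z) - f z = d * 'D_v f (t *: v + z).
Proof.
move=> d0 df.
have dl t : t \in `[0, d] ->
    is_derive t (1 : R) (fun s : R => f (s *: v + z)) ('D_v f (t *: v + z)).
  by rewrite in_itv /= => td; exact/is_derive_line/df.
have dlo t : t \in `]0, d[ ->
    is_derive t (1 : R) (fun s : R => f (s *: v + z)) ('D_v f (t *: v + z)).
  by move=> /subset_itv_oo_cc; exact: dl.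
have cl : {within `[0, d], continuous (fun s : R => f (s *: v + z))}.
  by apply: derivable_within_continuous => t /dl dt; exact: ex_derive.
have [t] := MVT d0 dlo cl.
rewrite in_itv /= => /andP[/ltW t0 /ltW td].
by rewrite scale0r add0r subr0 mulrC => E; exists t; rewrite ?t0.
Qed.

Lemma derive_translate f w v z :
  'D_v (f \o (fun x => w + x)) z = 'D_v f (w + z).
Proof.
rewrite /derive; do 2!f_equal.
by apply/funext => h /=; rewrite addrCA.
Qed.

(* Schwarz's theorem: the second difference is symmetric in [u] and [v], and
   each order of the mean value theorem gives one of the mixed derivatives. *)
Lemma second_difference U f u v z (d : R) : 0 < d ->
  (forall s t, 0 <= s <= d -> 0 <= t <= d -> U (s *: u + (t *: v + z))) ->
  (forall x, U x -> differentiable f x) ->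
  (forall x, U x -> differentiable (fun y => 'D_v f y) x) ->
  exists s t, [/\ 0 <= s <= d, 0 <= t <= d &
    f (d *: u + (d *: v + z)) - f (d *: u + z) - (f (d *: v + z) - f z) =
    d * (d * 'D_u (fun y => 'D_v f y) (s *: u + (t *: v + z)))].
Proof.
move=> d0 dU df dDf.
have d0d : 0 <= d <= d by rewrite lexx ltW.
have z0d : (0 : R) <= 0 <= d by rewrite lexx ltW.
(* The increment of [g] along [d *: v] is the second difference of [f]. *)
pose g x := f (d *: u + x) - f x.
have Us t : 0 <= t <= d -> U (d *: u + (t *: v + z)) by exact: dU.
have U0 t : 0 <= t <= d -> U (t *: v + z).
  by move=> /(dU 0 t z0d); rewrite scale0r add0r.
have dfs t : 0 <= t <= d ->
    differentiable (f \o (fun x => d *: u + x)) (t *: v + z).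
  move=> td; apply: differentiable_comp; last exact/df/Us.
  by apply: differentiableD => //; exact: differentiable_cst.
have [t td|t td E] := @MVT_line g v z d d0.
  by apply: differentiableB; [exact: dfs|exact: df (U0 _ td)].
have Dg : 'D_v g (t *: v + z) =
    'D_v f (d *: u + (t *: v + z)) - 'D_v f (t *: v + z).
  rewrite deriveB; last 2 first.
  - by apply: diff_derivable; exact: dfs.
  - by apply: diff_derivable; exact: df (U0 _ td).
  by rewrite derive_translate.
(* A second mean value, now along [u] and for the derivative of [f] along [v]. *)
have [s sd|s sd E'] := @MVT_line (fun y => 'D_v f y) u (t *: v + z) d d0.
  exact/dDf/dU.
by exists s, t; split=> //; rewrite -E' -Dg -E /g; ring.
Qed.

(** Provides one size [d] for which the intermediate points of both orders of differentiation stay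
    in [U] and near [z], whatever their position in the parallelogram. *)
Lemma near_parallelogram U (g1 g2 : V -> R) u v z (e : R) : open U -> U z ->
  {for z, continuous g1} -> {for z, continuous g2} -> 0 < e ->
  exists2 d : R, 0 < d & forall s t, 0 <= s <= d -> 0 <= t <= d ->
    [/\ U (s *: u + (t *: v + z)),
        `|g1 (s *: u + (t *: v + z)) - g1 z| <= e &
        `|g2 (s *: u + (t *: v + z)) - g2 z| <= e].
Proof.
move=> oU Uz /cvgrPdist_le c1 /cvgrPdist_le c2 e0.
have nP : \forall x \near z, [/\ U x, `|g1 x - g1 z| <= e & `|g2 x - g2 z| <= e].
  apply: filterS3 (open_nbhs_nbhs (conj oU Uz)) (c1 _ e0) (c2 _ e0) => x Ux h1 h2.
  by split; rewrite // distrC.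
have [r /= r0 rP] := (nbhs_ballP _ _).1 nP.
(* The summand 1 keeps the denominator positive even for zero vectors and makes the bound on the
   norm of [s *: u + t *: v] strictly smaller than [r]. *)
pose d := r / (1 + `|u| + `|v|).
have m0 : 0 < 1 + `|u| + `|v| by rewrite -addrA ltr_pwDl// addr_ge0.
exists d; first by rewrite divr_gt0.
move=> s t /andP[s0 sd] /andP[t0 td]; apply: rP; rewrite -ball_normE /=.
rewrite addrA opprD [z + _]addrC subrK normrN.
rewrite (le_lt_trans (ler_normD _ _))// !normrZ !ger0_norm//.
rewrite (@le_lt_trans _ _ (d * `|u| + d * `|v|)) ?lerD ?ler_wpM2r//.
by rewrite -mulrDr mulrAC ltr_pdivrMr// ltr_pM2l// -addrA ltrDr.
Qed.

Lemma dist_le_of_eq_scaled (a b c c' d e : R) : 0 < d ->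
  d * (d * c) = d * (d * c') -> `|c - a| <= e / 2 -> `|c' - b| <= e / 2 ->
  `|a - b| <= e.
Proof.
move=> /lt0r_neq0 d0 /(mulfI d0)/(mulfI d0) <- ca cb.
rewrite -(subrKA c) (le_trans (ler_normD _ _))// (splitr e) lerD//.
by rewrite distrC.
Qed.

(** Computing the second difference in both orders shows that the two mixed derivatives take the
    same value at two points of a small parallelogram; by continuity their values at [z] then differ
    by at most any [e > 0]. *)
Lemma derive_comm U f u v z : open U -> Ck_on 2 U f -> U z ->
  'D_u (fun x => 'D_v f x) z = 'D_v (fun x => 'D_u f x) z.
Proof.
move=> oU [df Df] Uz; apply/eqP; rewrite -subr_eq0 -normr_le0.
apply/ler_addgt0Pl => e e0; rewrite addr0.
have e2 : 0 < e / 2 by rewrite divr_gt0.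
have [d d0 dP] := near_parallelogram u v oU Uz ((Df v).2 u z Uz)
  ((Df u).2 v z Uz) e2.
have dU s t (sd : 0 <= s <= d) (td : 0 <= t <= d) : U (s *: u + (t *: v + z)).
  by have [] := dP s t sd td.
have [s [t [sd td E]]] := second_difference d0 dU df (fun x => (Df v).1 x).
have dU' t' s' : 0 <= t' <= d -> 0 <= s' <= d -> U (t' *: v + (s' *: u + z)).
  by move=> td' sd'; rewrite addrCA; exact: dU.
have [t' [s' [td' sd' E']]] := second_difference d0 dU' df (fun x => (Df u).1 x).
have [_ + _] := dP s t sd td; have [_ _] := dP s' t' sd' td'.
rewrite (addrCA (s' *: u)) => h2 h1.
apply: (dist_le_of_eq_scaled d0 _ h1 h2).
have swap (x y y' w : R) : x - y - (y' - w) = x - y' - (y - w) by ring.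
by apply: etrans (etrans (esym E) _) E'; rewrite (addrCA (d *: v)) swap.
Qed.

Lemma smooth_on_derive_comm U f u v z : open U -> smooth_on U f -> U z ->
  'D_u (fun x => 'D_v f x) z = 'D_v (fun x => 'D_u f x) z.
Proof. by move=> oU sf Uz; exact: derive_comm oU (sf 2%N) Uz. Qed.

End Schwarz.

(** * The adapted frame *)

Section LinearDirections.
#[local] Set Implicit Arguments.
#[local] Unset Strict Implicit.
Context {R : realType} {V W : normedModType R}.

Lemma derive_linear_comp (X : V -> W) (l : {linear W -> R}) (z v : V) :
  continuous l -> differentiable X z ->
  differentiable (l \o X) z /\ 'D_v (l \o X) z = l ('D_v X z).
Proof.
move=> cl dX; have dl : differentiable l (X z) by exact: linear_differentiable.
have dlX : differentiable (l \o X) z by exact: differentiable_comp.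
by split=> //; rewrite !deriveE// diff_comp//= diff_lin.
Qed.

Lemma derive_dir_sum (f : V -> W) (z : V) I (r : seq I) (v : I -> V) (c : I -> R) :
  differentiable f z ->
  'D_(\sum_(i <- r) c i *: v i) f z = \sum_(i <- r) c i *: 'D_(v i) f z.
Proof.
move=> df; rewrite deriveE// linear_sum; apply: eq_bigr => i _.
by rewrite linearZ deriveE.
Qed.

Lemma derive_dirD (f : V -> W) (z v w : V) : differentiable f z ->
  'D_(v + w) f z = 'D_v f z + 'D_w f z.
Proof. by move=> df; rewrite !deriveE// linearD. Qed.

End LinearDirections.

(* The derivatives of scalar functions are sealed: comparing two distinct
   derivatives makes unification unfold the limits that define them. *)
HB.lock Definition dderiv (R : realType) (V : normedModType R) (f : V -> R)
  (v z : V) : R := 'D_v f z.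
Arguments dderiv {R V} f v z.

(** * Coordinates of tangent vectors *)

Section PairCoordinates.
#[local] Set Implicit Arguments.
#[local] Unset Strict Implicit.
Context {R : realType} {N : nat}.
Local Notation Z := ('rV[R]_N * 'rV[R]_N)%type.

Definition coord1 (a : 'I_N) (X : Z) : R := X.1 0 a.
Definition coord2 (a : 'I_N) (X : Z) : R := X.2 0 a.

Lemma coord1_linear a : linear (coord1 a).
Proof. by move=> k X Y; rewrite /coord1 !mxE. Qed.

Lemma coord2_linear a : linear (coord2 a).
Proof. by move=> k X Y; rewrite /coord2 !mxE. Qed.

HB.instance Definition _ a :=
  GRing.isLinear.Build R Z R _ (coord1 a) (coord1_linear a).
HB.instance Definition _ a :=
  GRing.isLinear.Build R Z R _ (coord2 a) (coord2_linear a).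

Lemma coord1_continuous a : continuous (coord1 a).
Proof.
move=> X; apply: (continuous_comp (g := fun x : 'rV[R]_N => x 0 a)).
  exact: cvg_fst.
exact: coord_continuous.
Qed.

Lemma coord2_continuous a : continuous (coord2 a).
Proof.
move=> X; apply: (continuous_comp (g := fun x : 'rV[R]_N => x 0 a)).
  exact: cvg_snd.
exact: coord_continuous.
Qed.

Lemma coord_decomposition (X : Z) :
  X = \sum_a X.1 0 a *: ddx a + \sum_a X.2 0 a *: ddy a.
Proof.
apply: injective_projections.
  rewrite [LHS]row_sum_delta raddfD/= !(raddf_sum (@fst _ _))/=.
  by rewrite [X in _ = _ + X]big1 ?addr0// => a _; rewrite scaler0.
rewrite [LHS]row_sum_delta raddfD/= !(raddf_sum (@snd _ _))/=.
by rewrite [X in _ = X + _]big1 ?add0r// => a _; rewrite scaler0.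
Qed.

Lemma dderiv_coord (f : Z -> R) (z X : Z) : differentiable f z ->
  dderiv f X z = \sum_a X.1 0 a * dderiv f (ddx a) z
               + \sum_a X.2 0 a * dderiv f (ddy a) z.
Proof.
move=> df; rewrite dderiv.unlock {1}(coord_decomposition X) derive_dirD//.
by rewrite !derive_dir_sum.
Qed.

End PairCoordinates.

(** * Adapted components and the almost complex structure *)

Section AdaptedFrame.
#[local] Set Implicit Arguments.
#[local] Unset Strict Implicit.
Context {R : realType} {N : nat}.
Local Notation Z := ('rV[R]_N * 'rV[R]_N)%type.
Variable F : Z -> R.
Local Notation n := (nonlin_conn F).
Implicit Types (z X Y : Z) (a b c : 'I_N).

Lemma delta_y_is_linear a z : linear (delta_y F a z).
Proof.
move=> k X Y; rewrite /delta_y !mxE scalerDr addrACA; congr (_ + _).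
rewrite scaler_sumr -big_split; apply: eq_bigr => b _ /=.
by rewrite !mxE mulrDr mulrCA.
Qed.

HB.instance Definition _ a z :=
  GRing.isLinear.Build R Z R _ (delta_y F a z) (delta_y_is_linear a z).

Lemma delta_yB a z X Y : delta_y F a z (X - Y) = delta_y F a z X - delta_y F a z Y.
Proof. exact: raddfB. Qed.

Lemma coord1B a X Y : coord1 a (X - Y) = coord1 a X - coord1 a Y.
Proof. exact: raddfB. Qed.

(** The passage to adapted components is triangular: once [X.1] vanishes, [delta_y] reads off
    [X.2]. *)
Lemma adapted_eq0 z X : (forall a, coord1 a X = 0) ->
  (forall a, delta_y F a z X = 0) -> X = 0.
Proof.
move=> X1 Xv; apply: injective_projections; apply/rowP => a; rewrite [RHS]mxE.
  exact: X1.
have := Xv a; rewrite /delta_y big1 ?addr0// => b _.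
by rewrite [_ 0 b](X1 b) mulr0.
Qed.

Lemma coord1Z a k X : coord1 a (k *: X) = k * coord1 a X.
Proof. by rewrite /coord1 !mxE. Qed.

Lemma delta_yZ a z k X : delta_y F a z (k *: X) = k * delta_y F a z X.
Proof. by rewrite -[k *: X]addr0 delta_y_is_linear raddf0 addr0. Qed.

Lemma coord1_delta_x a b z : coord1 a (delta_x F b z) = (a == b)%:R.
Proof. by rewrite /coord1 delta_x1 mxE eqxx. Qed.

Lemma coord1_ddy a b : coord1 a (ddy b : Z) = 0.
Proof. by rewrite /coord1 mxE. Qed.

Lemma sum_indicator (x : 'I_N -> R) a : \sum_b x b * (a == b)%:R = x a.
Proof.
rewrite (bigD1 a)//= eqxx mulr1 big1 ?addr0// => b /negPf ba.
by rewrite eq_sym ba mulr0.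
Qed.

Lemma coord1_adapted a z (x y : 'I_N -> R) :
  coord1 a (\sum_b x b *: delta_x F b z + \sum_b y b *: ddy b) = x a.
Proof.
rewrite linearD !linear_sum /= -[RHS](sum_indicator x).
rewrite [X in _ + X]big1 => [|b _]; last by rewrite coord1Z coord1_ddy mulr0.
by rewrite addr0; apply: eq_bigr => b _; rewrite coord1Z coord1_delta_x.
Qed.

Lemma delta_y_adapted a z (x y : 'I_N -> R) :
  delta_y F a z (\sum_b x b *: delta_x F b z + \sum_b y b *: ddy b) = y a.
Proof.
rewrite linearD !linear_sum /= -[RHS](sum_indicator y).
rewrite big1 => [|b _]; last by rewrite delta_yZ delta_y_delta_x mulr0.
by rewrite add0r; apply: eq_bigr => b _; rewrite delta_yZ delta_y_ddy.
Qed.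

(** Puts J in the shape required by [coord1_adapted] and [delta_y_adapted]; in adapted components J
    is then (h, v) -> (v, -h). *)
Lemma Jmap_adapted z X : Jmap F z X =
  \sum_b delta_y F b z X *: delta_x F b z + \sum_b (- coord1 b X) *: ddy b.
Proof. by rewrite -big_split; apply: eq_bigr => a _ /=; rewrite scaleNr. Qed.

Lemma coord1_Jmap a z X : coord1 a (Jmap F z X) = delta_y F a z X.
Proof. by rewrite Jmap_adapted coord1_adapted. Qed.

Lemma delta_y_Jmap a z X : delta_y F a z (Jmap F z X) = - coord1 a X.
Proof. by rewrite Jmap_adapted delta_y_adapted. Qed.

Lemma adapted_decomposition z X :
  X = \sum_a coord1 a X *: delta_x F a z + \sum_a delta_y F a z X *: ddy a.
Proof.
apply/eqP; rewrite -subr_eq0; apply/eqP; apply: (@adapted_eq0 z) => a.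
  by rewrite coord1B coord1_adapted subrr.
by rewrite delta_yB delta_y_adapted subrr.
Qed.

(** Replaces the span by the common kernel of the forms [delta_y], against which brackets can be
    tested. *)
Lemma horizontalP z X : horizontal F z X <-> forall a, delta_y F a z X = 0.
Proof.
split=> [[h ->] a|X0].
  rewrite linear_sum big1//= => b _.
  by rewrite delta_yZ delta_y_delta_x mulr0.
exists X.1; rewrite {1}(adapted_decomposition z X).
by rewrite [X in _ + X]big1 ?addr0// => a _; rewrite X0 scale0r.
Qed.

Lemma sasaki_matsumotoJ z X Y :
  sasaki_matsumoto F z (Jmap F z X) (Jmap F z Y) = sasaki_matsumoto F z X Y.
Proof.
rewrite /sasaki_matsumoto addrC; congr (_ + _).
  apply: eq_bigr => a _; apply: eq_bigr => b _.
  by rewrite !delta_y_Jmap mulrNN.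
apply: eq_bigr => a _; apply: eq_bigr => b _.
by rewrite -!coord1_Jmap.
Qed.

End AdaptedFrame.

(** * Brackets and the Nijenhuis tensor in adapted components *)

Section AdaptedBracket.
#[local] Set Implicit Arguments.
#[local] Unset Strict Implicit.
Context {R : realType} {N : nat}.
Local Notation Z := ('rV[R]_N * 'rV[R]_N)%type.
Variables (F : Z -> R) (D : set Z).
Local Notation n := (nonlin_conn F).
Hypothesis sn : forall a b, smooth_on D (n a b).
Implicit Types (z x y : Z) (X Y : Z -> Z) (a b c : 'I_N) (W : set Z).

Let dn a b z : D z -> differentiable (n a b) z.
Proof. exact: smooth_on_differentiable. Qed.

(** The product rule: differentiating the field reproduces [delta_y], and differentiating the
    connection coefficients gives the remaining sum. *)
Lemma derive_delta_y a X z v : D z -> differentiable X z ->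
  differentiable (fun w => delta_y F a w (X w)) z /\
  'D_v (fun w => delta_y F a w (X w)) z =
  delta_y F a z ('D_v X z) + \sum_b dderiv (n a b) v z * coord1 b (X z).
Proof.
move=> Dz dX.
have -> : (fun w => delta_y F a w (X w)) =
    (coord2 a \o X) + \sum_b n a b * (coord1 b \o X).
  by apply/funext => w; rewrite fctE /= fct_sumE.
have [d2 E2] := derive_linear_comp v (@coord2_continuous R N a) dX.
have d1 b := (derive_linear_comp v (@coord1_continuous R N b) dX).1.
have E1 b := (derive_linear_comp v (@coord1_continuous R N b) dX).2.
have dp b : differentiable (n a b * (coord1 b \o X)) z.
  by apply: differentiableM; [exact: dn|exact: d1].
split; first by apply: differentiableD => //; exact: differentiable_sum.
rewrite deriveD; [|exact: diff_derivable|]; last first.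
  by apply: diff_derivable; exact: differentiable_sum.
rewrite derive_sum; last by move=> b; exact: diff_derivable.
rewrite E2 /delta_y -addrA; congr (_ + _); rewrite -big_split.
apply: eq_bigr => b _; rewrite deriveM; last 2 first.
- by apply: diff_derivable; exact: dn.
- by apply: diff_derivable; exact: d1.
by rewrite E1 dderiv.unlock; congr (_ + _); exact: mulrC.
Qed.

(* The part of the vertical component of a bracket that is tensorial in the two
   fields, once these are written in the adapted frame. *)
Definition conn_bracket a z x y : R :=
  \sum_b (dderiv (n a b) y z * coord1 b x - dderiv (n a b) x z * coord1 b y).

(** Cartan's formula for the exterior derivative of the 1-form [delta_y a]; [conn_bracket] is minus
    that exterior derivative. *)
Lemma delta_y_lie_bracket a X Y z : D z -> differentiable X z ->
  differentiable Y z ->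
  delta_y F a z (lie_bracket X Y z) =
  'D_(X z) (fun w => delta_y F a w (Y w)) z
  - 'D_(Y z) (fun w => delta_y F a w (X w)) z + conn_bracket a z (X z) (Y z).
Proof.
move=> Dz dX dY; rewrite /lie_bracket delta_yB.
have [_ ->] := derive_delta_y a (X z) Dz dY.
have [_ ->] := derive_delta_y a (Y z) Dz dX.
rewrite /conn_bracket sumrB.
have alg (p q s t : R) : p - q = p + s - (q + t) + (t - s) by ring.
exact: alg.
Qed.

(** Cartan's formula again, without a further term because dx^a is closed. *)
Lemma coord1_lie_bracket a X Y z : differentiable X z -> differentiable Y z ->
  coord1 a (lie_bracket X Y z) =
  'D_(X z) (coord1 a \o Y) z - 'D_(Y z) (coord1 a \o X) z.
Proof.
move=> dX dY; rewrite coord1B.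
have [_ ->] := derive_linear_comp (X z) (@coord1_continuous R N a) dY.
by have [_ ->] := derive_linear_comp (Y z) (@coord1_continuous R N a) dX.
Qed.

Lemma differentiable_coord1 a X z : differentiable X z ->
  differentiable (coord1 a \o X) z.
Proof. by case/(derive_linear_comp 0 (@coord1_continuous R N a)). Qed.

Lemma differentiable_Jmap X z : D z -> differentiable X z ->
  differentiable (fun w => Jmap F w (X w)) z.
Proof.
move=> Dz dX.
have -> : (fun w => Jmap F w (X w)) =
  \sum_a (fun w => coord1 a (Jmap F w (X w)) *: ddx a) +
  \sum_a (fun w => coord2 a (Jmap F w (X w)) *: ddy a).
  by apply/funext => w; rewrite fctE !fct_sumE [LHS]coord_decomposition.
have d1 a : differentiable (fun w => coord1 a (Jmap F w (X w))) z.
  have -> : (fun w => coord1 a (Jmap F w (X w))) = (fun w => delta_y F a w (X w)).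
    by apply/funext => w; rewrite coord1_Jmap.
  by have [] := derive_delta_y a 0 Dz dX.
have d2 a : differentiable (fun w => coord2 a (Jmap F w (X w))) z.
  (* The fibre component is recovered from [delta_y a w (Jmap F w (X w))], which is minus the base
     component of [X]. *)
  have -> : (fun w => coord2 a (Jmap F w (X w))) =
    - (coord1 a \o X) - \sum_b n a b * (fun w => coord1 b (Jmap F w (X w))).
    apply/funext => w; rewrite !fctE fct_sumE -(delta_y_Jmap F a w (X w)).
    by rewrite /delta_y addrK.
  apply: differentiableB; first exact/differentiableN/differentiable_coord1.
  apply: differentiable_sum => b; apply: differentiableM => //; exact: dn.
apply: differentiableD; apply: differentiable_sum => a; exact: differentiableZl.
Qed.

Lemma derive_delta_y_Jmap a X z v : differentiable X z ->
  'D_v (fun w => delta_y F a w (Jmap F w (X w))) z = - 'D_v (coord1 a \o X) z.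
Proof.
move=> dX; rewrite -deriveN; last exact/diff_derivable/differentiable_coord1.
by congr ('D_v _ z); apply/funext => w; rewrite delta_y_Jmap.
Qed.

Lemma derive_coord1_Jmap a X z v :
  'D_v (coord1 a \o (fun w => Jmap F w (X w))) z =
  'D_v (fun w => delta_y F a w (X w)) z.
Proof. by congr ('D_v _ z); apply/funext => w; exact: coord1_Jmap. Qed.

Lemma coord1_nijenhuis_term a z x y u v :
  coord1 a (x - Jmap F z y - Jmap F z u - v) =
  coord1 a x - delta_y F a z y - delta_y F a z u - coord1 a v.
Proof. by rewrite !coord1B !coord1_Jmap. Qed.

Lemma delta_y_nijenhuis_term a z x y u v :
  delta_y F a z (x - Jmap F z y - Jmap F z u - v) =
  delta_y F a z x - - coord1 a y - - coord1 a u - delta_y F a z v.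
Proof. by rewrite !delta_yB !delta_y_Jmap. Qed.

(** J permutes adapted components up to sign, so the derivatives of the components of [X] and [Y]
    cancel among the four brackets. What remains comes from the two brackets under J, whose vertical
    parts J makes horizontal. *)
Lemma coord1_nijenhuis a X Y z : D z -> differentiable X z ->
  differentiable Y z ->
  coord1 a (nijenhuis (Jmap F) X Y z) =
  - conn_bracket a z (Jmap F z (X z)) (Y z)
  - conn_bracket a z (X z) (Jmap F z (Y z)).
Proof.
move=> Dz dX dY.
have dJX := differentiable_Jmap Dz dX; have dJY := differentiable_Jmap Dz dY.
(* Applied as a term: rewriting with these equations makes unification compare
   and unfold the derivatives they contain. *)
have alg (g h u v p0 q0 p q r' r s' s t t' : R) : g = p0 - q0 -> p0 = p ->
    q0 = q -> h = p - r' + t -> r' = - r -> u = s' - q + t' -> s' = - s ->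
    v = s - r -> g - h - u - v = - t - t'.
  by move=> -> -> -> -> -> -> -> ->; ring.
apply: (etrans (coord1_nijenhuis_term _ _ _ _ _ _)).
exact: (alg _ _ _ _ _ _ _ _ _ _ _ _ _ _ (coord1_lie_bracket a dJX dJY)
  (derive_coord1_Jmap a Y z _) (derive_coord1_Jmap a X z _)
  (delta_y_lie_bracket a Dz dJX dY) (derive_delta_y_Jmap a _ dX)
  (delta_y_lie_bracket a Dz dX dJY) (derive_delta_y_Jmap a _ dY)
  (coord1_lie_bracket a dX dY)).
Qed.

(** The same cancellation; here the remaining terms come from [JX, JY] and [X, Y], whose vertical
    parts are read directly. *)
Lemma delta_y_nijenhuis a X Y z : D z -> differentiable X z ->
  differentiable Y z ->
  delta_y F a z (nijenhuis (Jmap F) X Y z) =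
  conn_bracket a z (Jmap F z (X z)) (Jmap F z (Y z))
  - conn_bracket a z (X z) (Y z).
Proof.
move=> Dz dX dY.
have dJX := differentiable_Jmap Dz dX; have dJY := differentiable_Jmap Dz dY.
have alg (g h u v p' q' r s p r0 q s0 t t' : R) : g = p' - q' + t ->
    p' = - p -> q' = - q -> h = p - r0 -> r0 = r -> u = s0 - q -> s0 = s ->
    v = s - r + t' -> g - - h - - u - v = t - t'.
  by move=> -> -> -> -> -> -> -> ->; ring.
apply: (etrans (delta_y_nijenhuis_term _ _ _ _ _ _)).
exact: (alg _ _ _ _ _ _ _ _ _ _ _ _ _ _ (delta_y_lie_bracket a Dz dJX dJY)
  (derive_delta_y_Jmap a _ dY) (derive_delta_y_Jmap a _ dX)
  (coord1_lie_bracket a dJX dY) (derive_coord1_Jmap a X z _)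
  (coord1_lie_bracket a dX dJY) (derive_coord1_Jmap a Y z _)
  (delta_y_lie_bracket a Dz dX dY)).
Qed.

End AdaptedBracket.

(** * Curvature *)

Section BilinearSums.
#[local] Set Implicit Arguments.
#[local] Unset Strict Implicit.
Context {R : realType} {N : nat}.
Implicit Types (A B P : 'I_N -> 'I_N -> R) (h k p q : 'I_N -> R).

Definition bilinear_sum B h k : R := \sum_b \sum_c B b c * (h b * k c).

Lemma bilinear_sumC B h k : (forall b c, B b c = B c b) ->
  bilinear_sum B h k = bilinear_sum B k h.
Proof.
move=> sB; rewrite /bilinear_sum exchange_big; apply: eq_bigr => b _.
by apply: eq_bigr => c _; rewrite sB [h _ * _]mulrC.
Qed.

Lemma bilinear_sumNr B h k :
  bilinear_sum B h (fun b => - k b) = - bilinear_sum B h k.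
Proof.
rewrite /bilinear_sum -sumrN; apply: eq_bigr => b _; rewrite -sumrN.
by apply: eq_bigr => c _; rewrite !mulrN.
Qed.

Lemma bilinear_sum0l B h k : (forall b, h b = 0) -> bilinear_sum B h k = 0.
Proof.
by move=> h0; rewrite /bilinear_sum big1// => b _; rewrite big1// => c _;
  rewrite h0 mul0r mulr0.
Qed.

Lemma bilinear_sum0r B h k : (forall b, k b = 0) -> bilinear_sum B h k = 0.
Proof.
by move=> k0; rewrite /bilinear_sum big1// => b _; rewrite big1// => c _;
  rewrite k0 !mulr0.
Qed.

Lemma bilinear_sum0 B h k : (forall b c, B b c = 0) -> bilinear_sum B h k = 0.
Proof.
by move=> B0; rewrite /bilinear_sum big1// => b _; rewrite big1// => c _;
  rewrite B0 mul0r.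
Qed.

Lemma bilinear_sum_indicator B b c :
  bilinear_sum B (fun d => (d == b)%:R) (fun d => (d == c)%:R) = B b c.
Proof.
rewrite /bilinear_sum (bigD1 b)//= [X in _ + X]big1 => [|e /negPf eb]; last first.
  by rewrite big1// => f _; rewrite eb mul0r mulr0.
rewrite addr0 (bigD1 c)//= [X in _ + X]big1 => [|e /negPf ec]; last first.
  by rewrite ec !mulr0.
by rewrite !eqxx !mulr1 addr0.
Qed.

(** To be read with [P] and [B] as the horizontal and vertical derivatives of the connection
    coefficients, and (h, p) and (k, q) as the adapted components of two vectors; the
    antisymmetrised [P] is then the curvature. *)
Lemma bilinear_sum_antisym P B h k p q :
  \sum_b ((\sum_c k c * P b c + \sum_c q c * B b c) * h b
         - (\sum_c h c * P b c + \sum_c p c * B b c) * k b) =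
  bilinear_sum (fun b c => P b c - P c b) h k + bilinear_sum B h q
  - bilinear_sum B k p.
Proof.
have -> : bilinear_sum (fun b c => P b c - P c b) h k =
    bilinear_sum P h k - bilinear_sum P k h.
  rewrite /bilinear_sum [X in _ - X]exchange_big -sumrB; apply: eq_bigr => b _.
  by rewrite -sumrB; apply: eq_bigr => c _; rewrite mulrBl [k c * _]mulrC.
have E u v w w' : \sum_b (\sum_c u c * P b c + \sum_c v c * B b c) * w b =
    bilinear_sum P w u + bilinear_sum B w v + w' - w'.
  rewrite addrK /bilinear_sum -big_split; apply: eq_bigr => b _ /=.
  by rewrite mulrDl !mulr_suml; congr (_ + _); apply: eq_bigr => c _; ring.
rewrite sumrB (E _ _ _ 0) (E _ _ _ 0); ring.
Qed.

End BilinearSums.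

(** The d/dy^a component of the bracket of [delta_x F b] and [delta_x F c]. Locked, like [dderiv],
    to keep unification from unfolding it. *)
HB.lock Definition curvature (R : realType) (N : nat)
    (F : 'rV[R]_N * 'rV[R]_N -> R) (a b c : 'I_N) (z : 'rV[R]_N * 'rV[R]_N) : R :=
  dderiv (nonlin_conn F a b) (delta_x F c z) z
  - dderiv (nonlin_conn F a c) (delta_x F b z) z.
Arguments curvature {R N} F a b c z.

(** The coefficients of the Berwald connection, that is, the second fibre derivatives of the
    spray. *)
HB.lock Definition berwald (R : realType) (N : nat)
    (F : 'rV[R]_N * 'rV[R]_N -> R) (a b c : 'I_N) (z : 'rV[R]_N * 'rV[R]_N) : R :=
  dderiv (nonlin_conn F a b) (ddy c) z.
Arguments berwald {R N} F a b c z.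

(** * Curvature as the obstruction to integrability of the two structures *)

Section Curvature.
#[local] Set Implicit Arguments.
#[local] Unset Strict Implicit.
Context {R : realType} {N : nat}.
Local Notation Z := ('rV[R]_N * 'rV[R]_N)%type.
Variables (F : Z -> R) (D : set Z).
Hypothesis oD : open D.
Hypothesis sn : forall a b, smooth_on D (nonlin_conn F a b).
Hypothesis berwald_sym : forall a b c z, D z ->
  berwald F a b c z = berwald F a c b z.
Implicit Types (z x y : Z) (X Y : Z -> Z) (a b c : 'I_N) (W : set Z).

Let K a z b c := curvature F a b c z.
Let B a z b c := berwald F a b c z.

(** The directions of differentiation are expanded in the adapted frame: their horizontal parts
    produce the curvature, their vertical parts the Berwald coefficients. *)
Lemma conn_bracketE a z x y : D z -> conn_bracket F a z x y =
  bilinear_sum (K a z) (coord1^~ x) (coord1^~ y)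
  + bilinear_sum (B a z) (coord1^~ x) (delta_y F ^~ z ^~ y)
  - bilinear_sum (B a z) (coord1^~ y) (delta_y F ^~ z ^~ x).
Proof.
move=> Dz.
have Dn v b : dderiv (nonlin_conn F a b) v z =
    \sum_c coord1 c v * dderiv (nonlin_conn F a b) (delta_x F c z) z
    + \sum_c delta_y F c z v * berwald F a b c z.
  have dn := smooth_on_differentiable (sn a b) Dz.
  rewrite berwald.unlock dderiv.unlock {1}(adapted_decomposition F z v).
  by rewrite derive_dirD// !derive_dir_sum.
rewrite /conn_bracket; under eq_bigr do rewrite !Dn.
rewrite bilinear_sum_antisym; congr (_ + _ - _).
by rewrite /K curvature.unlock.
Qed.

Lemma bilinear_sum_delta_x a z b c A :
  bilinear_sum A (coord1^~ (delta_x F b z)) (coord1^~ (delta_x F c z))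
  + bilinear_sum (B a z) (coord1^~ (delta_x F b z)) (delta_y F ^~ z ^~ (delta_x F c z))
  - bilinear_sum (B a z) (coord1^~ (delta_x F c z)) (delta_y F ^~ z ^~ (delta_x F b z))
  = A b c.
Proof.
rewrite [X in _ - X]bilinear_sum0r => [|d]; last exact: delta_y_delta_x.
rewrite [X in _ + X - _]bilinear_sum0r => [|d]; last exact: delta_y_delta_x.
rewrite addr0 subr0 -[RHS]bilinear_sum_indicator.
by congr bilinear_sum; apply/funext => d; exact: coord1_delta_x.
Qed.

(** For horizontal fields the derivatives of the [delta_y] components and the Berwald terms vanish,
    which leaves the curvature contracted with the base components. Applied to the frame fields
    [delta_x], this isolates each curvature coefficient. *)
Lemma integrable_horizontalP : integrable_on D (horizontal F) <->
  forall a b c z, D z -> curvature F a b c z = 0.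
Proof.
have alg (g p q r : R) : g = p - q + r -> p = 0 -> q = 0 -> g = r.
  by move=> -> -> ->; rewrite subrr add0r.
split=> [iH a b c z Dz|K0 W X Y oW WD sX sY hX hY z Wz].
  have sd d : smooth_on D (delta_x F d).
    have E : (fun w => ddx d + \sum_e (- nonlin_conn F e d w) *: ddy e) = delta_x F d.
      apply/funext => w; rewrite /delta_x -sumrN; congr (_ + _).
      by apply: eq_bigr => e _; rewrite scaleNr.
    rewrite -E; apply: smooth_onD => //; first exact: smooth_on_cst.
    apply: smooth_on_sum => // e; apply: smooth_onZl => //.
    exact: smooth_onN.
  have hd d w : D w -> horizontal F w (delta_x F d w).
    by move=> _; apply/horizontalP => e; rewrite delta_y_delta_x.
  have /horizontalP/(_ a) := iH D _ _ oD (@subset_refl _ D) (sd b) (sd c)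
    (hd b) (hd c) z Dz.
  have dd d := smooth_on_differentiable (sd d) Dz.
  have d0 d v : 'D_v (fun w => delta_y F a w (delta_x F d w)) z = 0.
    have -> : (fun w => delta_y F a w (delta_x F d w)) = cst 0.
      by apply/funext => w; rewrite delta_y_delta_x.
    exact: derive_cst.
  have E := alg _ _ _ _ (delta_y_lie_bracket sn a Dz (dd b) (dd c)) (d0 _ _) (d0 _ _).
  by move=> /(etrans (esym E)) <-; rewrite conn_bracketE// bilinear_sum_delta_x.
apply/horizontalP => a.
have Dz := WD _ Wz.
have dX := smooth_on_differentiable sX Wz.
have dY := smooth_on_differentiable sY Wz.
(* The [delta_y] components vanish on all of the open set [W], hence so do their derivatives at
   [z]. *)
have v0 U : (forall w, W w -> horizontal F w (U w)) ->
    forall v, 'D_v (fun w => delta_y F a w (U w)) z = 0.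
  move=> hU v; rewrite (eq_on_derive (g := cst 0) v oW Wz) ?derive_cst//.
  by move=> w /hU/horizontalP.
apply: etrans (alg _ _ _ _ (delta_y_lie_bracket sn a Dz dX dY) (v0 _ hY _)
  (v0 _ hX _)) _.
rewrite conn_bracketE// bilinear_sum0 => [|b c]; last exact: K0.
rewrite bilinear_sum0r; last by move: (hY z Wz) => /horizontalP.
by rewrite bilinear_sum0r ?addr0 ?subr0//; move: (hX z Wz) => /horizontalP.
Qed.

(** J sends [ddy] to [delta_x], so the vertical component of the Nijenhuis tensor on two fields
    [ddy b], [ddy c] is a curvature coefficient. Conversely, without curvature only Berwald terms
    are left, and these cancel by symmetry in the lower indices. *)
Lemma nijenhuis_eq0P :
  (forall W X Y, open W -> W `<=` D -> smooth_on W X -> smooth_on W Y ->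
     forall z, W z -> nijenhuis (Jmap F) X Y z = 0) <->
  forall a b c z, D z -> curvature F a b c z = 0.
Proof.
split=> [N0 a b c z Dz|K0 W X Y oW WD sX sY z Wz].
  have := N0 D (fun=> ddy b) (fun=> ddy c) oD (@subset_refl _ D)
    (@smooth_on_cst _ _ _ _ _) (@smooth_on_cst _ _ _ _ _) z Dz.
  move=> /(congr1 (delta_y F a z)).
  rewrite (delta_y_nijenhuis sn a Dz); [|exact: differentiable_cst..].
  rewrite raddf0 !(conn_bracketE _ _ _ Dz) !Jmap_ddy.
  have b1 A h d : bilinear_sum A (coord1^~ (ddy d : Z)) h = 0.
    by apply: bilinear_sum0l => e; exact: coord1_ddy.
  by rewrite bilinear_sum_delta_x !b1 addr0 !subr0.
have Dz := WD _ Wz.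
have dX := smooth_on_differentiable sX Wz.
have dY := smooth_on_differentiable sY Wz.
have T a x y : conn_bracket F a z x y =
    bilinear_sum (B a z) (coord1^~ x) (delta_y F ^~ z ^~ y)
    - bilinear_sum (B a z) (coord1^~ y) (delta_y F ^~ z ^~ x).
  by rewrite conn_bracketE// bilinear_sum0 ?add0r// => b c; exact: K0.
have J1 x : (coord1^~ (Jmap F z x)) = (delta_y F ^~ z ^~ x).
  by apply/funext => a; rewrite coord1_Jmap.
have J2 x : (delta_y F ^~ z ^~ (Jmap F z x)) = (fun a => - coord1 a x).
  by apply/funext => a; rewrite delta_y_Jmap.
have BC a h k : bilinear_sum (B a z) h k = bilinear_sum (B a z) k h.
  by apply: bilinear_sumC => b c; exact: berwald_sym.
apply: (@adapted_eq0 _ _ F z) => a.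
  rewrite (coord1_nijenhuis sn a Dz dX dY) !T !J1 !J2 !bilinear_sumNr.
  rewrite (BC a (delta_y F ^~ z ^~ (X z))) (BC a (coord1^~ (X z)) (coord1^~ (Y z))).
  move: (bilinear_sum _ _ _) (bilinear_sum _ _ _) => p q; ring.
rewrite (delta_y_nijenhuis sn a Dz dX dY) !T !J1 !J2 !bilinear_sumNr.
rewrite !(BC a (delta_y F ^~ z ^~ _)).
move: (bilinear_sum _ _ _) (bilinear_sum _ _ _) => p q; ring.
Qed.

End Curvature.

(** * The spray and the fundamental form *)

Section ScalarDerivatives.
#[local] Set Implicit Arguments.
#[local] Unset Strict Implicit.
Context {R : realType} {V : normedModType R}.
Implicit Types (U : set V) (f g : V -> R) (v z : V).

Lemma dderivE f v : dderiv f v = fun z => 'D_v f z.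
Proof. by apply/funext => z; rewrite dderiv.unlock. Qed.

Lemma dderiv_eq_on U f g v z : open U -> U z -> (forall x, U x -> f x = g x) ->
  dderiv f v z = dderiv g v z.
Proof. by move=> oU Uz fg; rewrite dderiv.unlock; exact: eq_on_derive oU Uz fg. Qed.

Lemma dderivM f g v z : differentiable f z -> differentiable g z ->
  dderiv (fun x => f x * g x) v z = f z * dderiv g v z + g z * dderiv f v z.
Proof.
by move=> df dg; rewrite dderiv.unlock; apply: deriveM; exact: diff_derivable.
Qed.

Lemma dderivB f g v z : differentiable f z -> differentiable g z ->
  dderiv (fun x => f x - g x) v z = dderiv f v z - dderiv g v z.
Proof.
by move=> df dg; rewrite dderiv.unlock; apply: deriveB; exact: diff_derivable.
Qed.

Lemma dderivMl f (k : R) v z : differentiable f z ->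
  dderiv (fun x => k * f x) v z = k * dderiv f v z.
Proof.
by move=> df; rewrite dderiv.unlock; apply: deriveZ; exact: diff_derivable.
Qed.

Lemma dderiv_sum n (f : 'I_n -> V -> R) v z : (forall i, differentiable (f i) z) ->
  dderiv (fun x => \sum_i f i x) v z = \sum_i dderiv (f i) v z.
Proof.
move=> df; rewrite dderiv.unlock -fct_sumE; apply: derive_sum => i.
exact: diff_derivable.
Qed.

Lemma dderiv_comm U f u v z : open U -> smooth_on U f -> U z ->
  dderiv (dderiv f v) u z = dderiv (dderiv f u) v z.
Proof.
move=> oU sf Uz; rewrite !dderivE; exact: smooth_on_derive_comm oU sf Uz.
Qed.

Lemma smooth_on_dderiv U f v : smooth_on U f -> smooth_on U (dderiv f v).
Proof. by move=> sf; rewrite dderivE; exact: smooth_on_derive. Qed.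

Lemma smooth_on_linear U (l : {linear V -> R}) : continuous l -> smooth_on U l.
Proof.
move=> cl [|k]; first by move=> x _; exact: cl.
split=> [x _|v]; first exact: linear_differentiable.
have -> : (fun x => 'D_v l x) = fun=> l v; last exact: Ck_on_cst.
apply/funext => x; rewrite deriveE; last exact: linear_differentiable.
by rewrite diff_lin.
Qed.

End ScalarDerivatives.

(** * The spray and the nonlinear connection *)

Section LocalSpray.
#[local] Set Implicit Arguments.
#[local] Unset Strict Implicit.
Context {R : realType} {N : nat}.
Local Notation Z := ('rV[R]_N * 'rV[R]_N)%type.
Variables (F : Z -> R) (D : set Z).
Hypothesis oD : open D.
Hypothesis sE : smooth_on D (Fsq F).
Hypothesis ug : forall z, D z -> fund_tensor F z \in unitmx.
Implicit Types (z x y : Z) (X Y : Z -> Z) (a b c : 'I_N).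

Local Notation E := (Fsq F).

Lemma fund_tensorE a b z :
  fund_tensor F z a b = 2^-1 * dderiv (dderiv E (ddy b)) (ddy a) z.
Proof. by rewrite mxE !dderivE. Qed.

(** Four times the spray with its index lowered, as [lowered_spray] shows. *)
Definition spray_rhs a z : R :=
  \sum_c dderiv (dderiv E (ddx c)) (ddy a) z * coord2 c z - dderiv E (ddx a) z.

Lemma spray_coefE a z : spray_coef F a z =
  4^-1 * \sum_b invmx (fund_tensor F z) a b * spray_rhs b z.
Proof.
rewrite /spray_coef; congr (_ * _); apply: eq_bigr => b _; congr (_ * _).
rewrite /spray_rhs dderivE; congr (_ - _); apply: eq_bigr => c _.
by rewrite !dderivE.
Qed.

Lemma nonlin_connE a b z : nonlin_conn F a b z = dderiv (spray_coef F a) (ddy b) z.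
Proof. by rewrite dderivE. Qed.

Lemma smooth_fund_tensor a b : smooth_on D (fun z => fund_tensor F z a b).
Proof.
under eq_fun do rewrite fund_tensorE.
apply: smooth_onM => //; first exact: smooth_on_cst.
by do 2!apply: smooth_on_dderiv.
Qed.

Lemma smooth_spray_rhs a : smooth_on D (spray_rhs a).
Proof.
apply: smooth_onD => //; last first.
  by apply: smooth_onN => //; exact: smooth_on_dderiv.
apply: smooth_on_sum => // c; apply: smooth_onM => //.
  by do 2!apply: smooth_on_dderiv.
exact/smooth_on_linear/coord2_continuous.
Qed.

Lemma smooth_spray_coef a : smooth_on D (spray_coef F a).
Proof.
have -> : spray_coef F a = fun z =>
    4^-1 * \sum_b invmx (fund_tensor F z) a b * spray_rhs b z.
  by apply/funext => z; exact: spray_coefE.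
apply: smooth_onM => //; first exact: smooth_on_cst.
apply: smooth_on_sum => // b; apply: smooth_onM => //; last exact: smooth_spray_rhs.
by apply: smooth_on_invmx => //; exact: smooth_fund_tensor.
Qed.

Lemma smooth_nonlin_conn a b : smooth_on D (nonlin_conn F a b).
Proof. exact/smooth_on_derive/smooth_spray_coef. Qed.

Lemma berwald_sym a b c z : D z -> berwald F a b c z = berwald F a c b z.
Proof.
move=> Dz; rewrite berwald.unlock.
have N' d : nonlin_conn F a d = dderiv (spray_coef F a) (ddy d).
  by apply/funext => w; exact: nonlin_connE.
rewrite !N'; exact: (dderiv_comm _ _ oD (smooth_spray_coef a) Dz).
Qed.

(** Lowering the index removes the inverse matrix from the spray, so that later differentiations
    only meet [fund_tensor] itself. *)
Lemma lowered_spray a z : D z ->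
  \sum_b fund_tensor F z a b * spray_coef F b z = 4^-1 * spray_rhs a z.
Proof.
move=> Dz; pose w : 'cV[R]_N := \col_b spray_rhs b z.
have Gw b : spray_coef F b z = (4^-1 *: (invmx (fund_tensor F z) *m w)) b 0.
  rewrite spray_coefE !mxE; congr (_ * _); apply: eq_bigr => c _.
  by rewrite mxE.
have : fund_tensor F z *m (4^-1 *: (invmx (fund_tensor F z) *m w)) = 4^-1 *: w.
  by rewrite -scalemxAr mulKVmx// ug.
move=> /matrixP/(_ a 0); rewrite mxE => e.
under eq_bigr do rewrite Gw.
by rewrite e !mxE.
Qed.

(** The identity [lowered_spray] holds on an open set and is differentiated along [ddy c]; the
    product-rule term containing the derivative of g_ab is moved to the right. *)
Lemma lowered_nonlin_conn a c z : D z ->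
  \sum_b fund_tensor F z a b * nonlin_conn F b c z =
  4^-1 * (\sum_d dderiv (dderiv (dderiv E (ddx d)) (ddy a)) (ddy c) z * coord2 d z
          + dderiv (dderiv E (ddx c)) (ddy a) z
          - dderiv (dderiv E (ddx a)) (ddy c) z)
  - \sum_b spray_coef F b z * dderiv (fun w => fund_tensor F w a b) (ddy c) z.
Proof.
move=> Dz.
have dg b := smooth_on_differentiable (smooth_fund_tensor a b) Dz.
have dG b := smooth_on_differentiable (smooth_spray_coef b) Dz.
have dr b := smooth_on_differentiable (smooth_spray_rhs b) Dz.
have := dderiv_eq_on (ddy c) oD Dz (lowered_spray a).
rewrite dderivMl// dderiv_sum => [|b]; last exact: differentiableM.
under eq_bigr => b _ do rewrite (dderivM (ddy c) (dg b) (dG b)).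
rewrite big_split /= => /(canRL (addrK _)).
under eq_bigr do rewrite -nonlin_connE.
move=> ->; congr (4^-1 * _ - _).
have ds v w : differentiable (dderiv (dderiv E v) w) z.
  apply: smooth_on_differentiable Dz.
  by do 2!apply: smooth_on_dderiv.
have dl d : differentiable (@coord2 R N d) z.
  exact/linear_differentiable/coord2_continuous.
have d1 v : differentiable (dderiv E v) z.
  by apply: smooth_on_differentiable Dz; exact: smooth_on_dderiv.
rewrite dderivB//; last first.
  rewrite -fct_sumE; apply: differentiable_sum => d; exact: differentiableM.
congr (_ - _); rewrite dderiv_sum => [|d]; last exact: differentiableM.
rewrite (eq_bigr _ (fun d _ => dderivM (ddy c) (ds _ _) (dl d))).
rewrite big_split /= [LHS]addrC; congr (_ + _).
  by apply: eq_bigr => d _; rewrite mulrC.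
(* The derivative of y^d along [ddy c] is a Kronecker symbol, which selects the term with d = c. *)
rewrite -[RHS](sum_indicator (fun d => dderiv (dderiv E (ddx d)) (ddy a) z) c).
apply: eq_bigr => d _; congr (_ * _).
rewrite dderivE deriveE// diff_lin; last exact: coord2_continuous.
by rewrite [LHS]mxE eqxx eq_sym.
Qed.

Lemma fund_tensor_sym a b z : D z -> fund_tensor F z a b = fund_tensor F z b a.
Proof.
by move=> Dz; rewrite !fund_tensorE (dderiv_comm _ _ oD sE Dz).
Qed.

(* Lowering the spray and differentiating along [ddy c], the antisymmetric part
   in [a] and [c] loses the terms in third derivatives of [E]. *)
Lemma lagrangian_connection a c z : D z ->
  \sum_b fund_tensor F z a b * nonlin_conn F b c z -
  \sum_b fund_tensor F z c b * nonlin_conn F b a z =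
  2^-1 * (dderiv (dderiv E (ddx c)) (ddy a) z - dderiv (dderiv E (ddx a)) (ddy c) z).
Proof.
move=> Dz.
have alg (g h s s' t t' p q : R) : g = 4^-1 * (s + p - q) - t ->
    h = 4^-1 * (s' + q - p) - t' -> s = s' -> t = t' -> g - h = 2^-1 * (p - q).
  by move=> -> -> -> ->; field.
apply: (alg _ _ _ _ _ _ _ _ (lowered_nonlin_conn a c Dz)
  (lowered_nonlin_conn c a Dz)).
  apply: eq_bigr => d _; congr (_ * _).
  exact: (dderiv_comm _ _ oD (smooth_on_dderiv _ sE) Dz).
apply: eq_bigr => b _; congr (_ * _).
have d2 d : differentiable (dderiv (dderiv E (ddy b)) d) z.
  apply: smooth_on_differentiable Dz.
  by do 2!apply: smooth_on_dderiv.
have fE d : (fun w => fund_tensor F w d b) =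
    (fun w => 2^-1 * dderiv (dderiv E (ddy b)) (ddy d) w).
  by apply/funext => w; exact: fund_tensorE.
rewrite !fE !dderivMl//; congr (_ * _).
exact: (dderiv_comm _ _ oD (smooth_on_dderiv _ sE) Dz).
Qed.

End LocalSpray.

(** * The fundamental 2-form *)

Section KahlerForm.
#[local] Set Implicit Arguments.
#[local] Unset Strict Implicit.
Context {R : realType} {N : nat}.
Local Notation Z := ('rV[R]_N * 'rV[R]_N)%type.
Variables (F : Z -> R) (D : set Z).
Hypothesis oD : open D.
Hypothesis sE : smooth_on D (Fsq F).
Hypothesis ug : forall z, D z -> fund_tensor F z \in unitmx.
Implicit Types (z u v w : Z) (a b c : 'I_N).

Local Notation E := (Fsq F).

(* [dE/dy^a dx^a], evaluated on the constant field [u]. *)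
Definition hilbert_form (u : Z) : Z -> R := dderiv E (0, u.1).

Lemma bilinear_sum_swap (B : 'I_N -> 'I_N -> R) h k :
  bilinear_sum B h k = bilinear_sum (fun b c => B c b) k h.
Proof.
rewrite /bilinear_sum exchange_big; apply: eq_bigr => b _; apply: eq_bigr => c _.
by rewrite [h _ * _]mulrC.
Qed.

(** The index computation behind [kahler_form_exact] at a fixed point, where [H a b] stands for
    d^2E/dy^a dx^b. Only the antisymmetric part of g_ab n^b_c enters, and the second hypothesis
    expresses it through [H]. *)
Lemma kahler_form_algebra (g n H : 'I_N -> 'I_N -> R) (u1 u2 w1 w2 : 'I_N -> R) :
  (forall a b, g a b = g b a) ->
  (forall a c, \sum_b g a b * n b c - \sum_b g c b * n b a =
     2^-1 * (H a c - H c a)) ->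
  \sum_a \sum_b g a b * (u1 a * (w2 b + \sum_c n b c * w1 c)) +
  \sum_a \sum_b g a b * ((u2 a + \sum_c n a c * u1 c) * - w1 b) =
  2^-1 * (\sum_a u1 a * (\sum_b w1 b * H a b + \sum_b w2 b * (2 * g b a)) -
          \sum_a w1 a * (\sum_b u1 b * H a b + \sum_b u2 b * (2 * g b a))).
Proof.
move=> gC gn.
pose Q a c := \sum_b g a b * n b c.
have L1 h k : \sum_a \sum_b g a b * (h a * (\sum_c n b c * k c)) =
    bilinear_sum Q h k.
  rewrite /bilinear_sum /Q; apply: eq_bigr => a _.
  under [RHS]eq_bigr do rewrite mulr_suml.
  rewrite exchange_big; apply: eq_bigr => b _ /=; rewrite !mulr_sumr.
  by apply: eq_bigr => c _; ring.
have R1 h k k' : \sum_a h a * (\sum_b k b * H a b + \sum_b k' b * (2 * g b a)) =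
    bilinear_sum H h k + 2 * bilinear_sum g h k'.
  rewrite /bilinear_sum mulr_sumr -big_split; apply: eq_bigr => a _ /=.
  rewrite mulrDr !mulr_sumr; congr (_ + _); apply: eq_bigr => b _; first ring.
  by rewrite gC; ring.
have -> : \sum_a \sum_b g a b * (u1 a * (w2 b + \sum_c n b c * w1 c)) =
    bilinear_sum g u1 w2 + bilinear_sum Q u1 w1.
  rewrite -L1 /bilinear_sum -big_split; apply: eq_bigr => a _ /=.
  by rewrite -big_split; apply: eq_bigr => b _ /=; ring.
have -> : \sum_a \sum_b g a b * ((u2 a + \sum_c n a c * u1 c) * - w1 b) =
    - bilinear_sum g w1 u2 - bilinear_sum Q w1 u1.
  rewrite -L1 /bilinear_sum exchange_big -opprD -big_split -sumrN.
  apply: eq_bigr => a _ /=; rewrite -big_split -sumrN; apply: eq_bigr => b _ /=.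
  by rewrite gC; ring.
rewrite !R1.
have QH : bilinear_sum Q u1 w1 - bilinear_sum Q w1 u1 =
    2^-1 * (bilinear_sum H u1 w1 - bilinear_sum H w1 u1).
  rewrite [bilinear_sum Q w1 _]bilinear_sum_swap [bilinear_sum H w1 _]bilinear_sum_swap.
  rewrite /bilinear_sum -!sumrB mulr_sumr; apply: eq_bigr => a _.
  rewrite -!sumrB mulr_sumr; apply: eq_bigr => b _.
  by rewrite -!mulrBl [RHS]mulrA -(gn a b).
rewrite opprD addrACA.
move: QH; set q := bilinear_sum Q _ _; set q' := bilinear_sum Q _ _.
move=> /(canRL (subrK _)) ->.
by field.
Qed.

Lemma smooth_hilbert_form u : smooth_on D (hilbert_form u).
Proof. exact: smooth_on_dderiv. Qed.

Lemma hilbert_formE u z : D z ->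
  hilbert_form u z = \sum_a u.1 0 a * dderiv E (ddy a) z.
Proof.
move=> Dz; rewrite /hilbert_form dderiv_coord/=; last exact: smooth_on_differentiable Dz.
by rewrite big1 ?add0r// => a _; rewrite mxE mul0r.
Qed.

(** As [u] is constant, only the factors dE/dy^a are differentiated; their fibre derivatives are
    twice the fundamental tensor. *)
Lemma dderiv_hilbert_form u w z : D z -> dderiv (hilbert_form u) w z =
  \sum_a u.1 0 a * (\sum_b w.1 0 b * dderiv (dderiv E (ddx b)) (ddy a) z
                   + \sum_b w.2 0 b * (2 * fund_tensor F z b a)).
Proof.
move=> Dz; rewrite (dderiv_eq_on _ oD Dz (hilbert_formE u)).
have d1 v : differentiable (dderiv E v) z.
  by apply: smooth_on_differentiable Dz; exact: smooth_on_dderiv.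
have dM a : differentiable (fun x => u.1 0 a * dderiv E (ddy a) x) z.
  exact: differentiableZ.
rewrite (dderiv_sum _ dM); apply: eq_bigr => a _.
rewrite (dderivMl _ _ (d1 _)) dderiv_coord//; congr (_ * (_ + _)).
  apply: eq_bigr => b _; congr (_ * _); exact: dderiv_comm oD sE Dz.
apply: eq_bigr => b _; congr (_ * _).
by rewrite fund_tensorE mulrA divff ?mul1r.
Qed.

(* Minus half the exterior derivative of [hilbert_form]. *)
Lemma kahler_form_exact z u w : D z ->
  sasaki_matsumoto F z u (Jmap F z w) =
  2^-1 * (dderiv (hilbert_form u) w z - dderiv (hilbert_form w) u z).
Proof.
move=> Dz; rewrite !dderiv_hilbert_form//.
rewrite -(kahler_form_algebra _ _ (n := fun a b => nonlin_conn F a b z)).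
- rewrite /sasaki_matsumoto; congr (_ + _); apply: eq_bigr => a _;
    apply: eq_bigr => b _; congr (_ * (_ * _)).
    by rewrite [LHS]coord1_Jmap.
  by rewrite delta_y_Jmap.
- by move=> a b; exact: (fund_tensor_sym oD sE a b Dz).
- by move=> a c; exact: (lagrangian_connection oD sE ug a c Dz).
Qed.

(** By exactness this is d^2 = 0: the six second derivatives of [hilbert_form] cancel in pairs by
    Schwarz's theorem. *)
Lemma kahler_form_closed :
  closed_2form D (fun z u v => sasaki_matsumoto F z u (Jmap F z v)).
Proof.
move=> z Dz u v w.
have dd x y : differentiable (dderiv (hilbert_form x) y) z.
  apply: smooth_on_differentiable Dz.
  by apply: smooth_on_dderiv; exact: smooth_hilbert_form.
have P t x y : 'D_t (fun z' => sasaki_matsumoto F z' x (Jmap F z' y)) z =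
    2^-1 * (dderiv (dderiv (hilbert_form x) y) t z
           - dderiv (dderiv (hilbert_form y) x) t z).
  rewrite (eq_on_derive t oD Dz (fun z' Dz' => kahler_form_exact x y Dz')).
  have := dderivMl 2^-1 t (differentiableB (dd x y) (dd y x)).
  by rewrite {1}dderiv.unlock (dderivB t (dd x y) (dd y x)).
have C x s t : dderiv (dderiv (hilbert_form x) s) t z =
    dderiv (dderiv (hilbert_form x) t) s z.
  exact: dderiv_comm oD (smooth_hilbert_form x) Dz.
have alg (p q r p' q' r' e1 e2 e3 : R) : e1 = 2^-1 * (p - q) ->
    e2 = 2^-1 * (r - q') -> e3 = 2^-1 * (r' - p') -> p = p' -> q = q' -> r = r' ->
    e1 - e2 + e3 = 0.
  by move=> -> -> -> -> -> ->; field.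
exact: (alg _ _ _ _ _ _ _ _ _ (P u v w) (P v u w) (P w u v)
  (C _ _ _) (C _ _ _) (C _ _ _)).
Qed.

Lemma kahlerian_iff_integrable :
  kahlerian_on D (sasaki_matsumoto F) (Jmap F) <-> integrable_on D (horizontal F).
Proof.
have sn := smooth_nonlin_conn oD sE ug.
have HI := integrable_horizontalP oD sn.
have HN := nijenhuis_eq0P oD sn (berwald_sym oD sE ug).
split=> [[_ _ N0]|iH]; first by apply/HI/HN.
split; [|exact: kahler_form_closed|by apply/HN/HI].
by move=> z _ u v; exact: sasaki_matsumotoJ.
Qed.

End KahlerForm.

(** * Doubly warped products *)

Section TangentCoordinates.
#[local] Set Implicit Arguments.
#[local] Unset Strict Implicit.
Context {R : realType} {n : nat} (M : manifold R n).
Implicit Types (c : chart R n M) (x y v : 'rV[R]_n).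

(** The reverse transition map composed with this one is the identity near [x], so the chain rule
    gives the differential a left inverse. *)
Lemma transition_diff_inj c x v : atlas c -> cimg c x ->
  'd (cmap (chart_at (cinv c x)) \o cinv c) x v = 0 -> v = 0.
Proof.
move=> ac cx; set p := cinv c x; set d := chart_at p.
have dp : cdom d p := chart_at_dom p.
have ad : atlas d := chart_at_atlas p.
pose f := cmap d \o cinv c; pose g := cmap c \o cinv d.
have df : differentiable f x.
  exact: (smooth_on_differentiable (transition_smooth ac ad)).
have dg : differentiable g (f x).
  apply: (smooth_on_differentiable (transition_smooth ad ac)); split.
    exact: cmap_img.
  by rewrite /f /= cmapK//; exact: cinv_dom.
(* Continuity of [cinv c] at [x] keeps nearby points inside the domain of the second chart. *)
have gf : \forall w \near x, (g \o f) w = id w.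
  have n1 : \forall w \near x, cimg c w.
    by apply: open_nbhs_nbhs; split=> //; exact: cimg_open.
  have n2 : \forall w \near x, cdom d (cinv c w).
    apply: (cinv_continuous cx); apply: open_nbhs_nbhs; split=> //.
    exact: cdom_open.
  by apply: filterS2 n1 n2 => w cw dw; rewrite /g /f /= cmapK// cinvK.
have : 'd g (f x) ('d f x v) = v.
  rewrite -[RHS](derive_id x v) -(near_eq_derive _ gf).
  rewrite (deriveE _ (differentiable_comp df dg)).
  exact: (congr1 (fun h => h v) (esym (diff_comp df dg))).
by move=> + f0; rewrite [X in 'd g _ X]f0 linear0.
Qed.

Lemma slit_coord_open c : open (slit_coord c).
Proof.
have -> : slit_coord c = fst @^-1` cimg c `&` snd @^-1` ~` [set 0].
  by apply/seteqP; split=> z /= [cz /eqP z0].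
apply: openI; apply: open_comp.
- by move=> z _; exact: cvg_fst.
- exact: cimg_open.
- by move=> z _; exact: cvg_snd.
- rewrite openC; apply: accessible_closed_set1; exact/hausdorff_accessible/norm_hausdorff.
Qed.

(** Relates derivatives in the induced coordinates to the fibrewise ones of [finsler_posdef]. *)
Lemma derive_fiber (W : normedModType R) (f : 'rV[R]_n * 'rV[R]_n -> W) x y v :
  'D_(0, v) f (x, y) = 'D_v (fun y' => f (x, y')) y.
Proof.
rewrite /derive; do 2!f_equal; apply/funext => h /=.
have -> // : h *: ((0, v) : 'rV[R]_n * 'rV[R]_n) + (x, y) = (x, h *: v + y).
by apply: injective_projections; rewrite /= ?scaler0 ?add0r.
Qed.

Variable F : TM M -> R.
Hypothesis hF : finsler F.

(* Normalised as in the positivity condition of [finsler]. *)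
Definition half_square c (z : 'rV[R]_n * 'rV[R]_n) : R :=
  F (tangent_of_coord c z) ^+ 2 / 2.

Lemma smooth_half_square c : atlas c ->
  smooth_on (slit_coord c) (half_square c).
Proof.
move=> ac; have sF := finsler_smooth hF ac; have oS := slit_coord_open (c := c).
apply: smooth_onM => //; last exact: smooth_on_cst.
exact: smooth_onM.
Qed.

(** On the fibre over a fixed [x] the change to the preferred chart is the linear map [T], so both
    derivatives along [(0, v)] become derivatives along [T v] at [T y]. Injectivity of [T] keeps
    these vectors nonzero, and [finsler_posdef] applies. *)
Lemma half_square_posdef c x y v : atlas c -> slit_coord c (x, y) -> v != 0 ->
  0 < 'D_(0, v) (fun z => 'D_(0, v) (half_square c) z) (x, y).
Proof.
move=> ac [/= cx y0] v0.
set T : {linear _ -> _} := 'd (cmap (chart_at (cinv c x)) \o cinv c) x.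
have T0 w : w != 0 -> T w != 0.
  by apply: contra_neq; exact: transition_diff_inj.
pose f w := F (cinv c x, w) ^+ 2 / 2.
have E y' : 'D_(0, v) (half_square c) (x, y') = 'D_(T v) f (T y').
  by rewrite derive_fiber -derive_comp_linear.
have E2 : 'D_(0, v) (fun z => 'D_(0, v) (half_square c) z) (x, y) =
    'D_(T v) (fun w => 'D_(T v) f w) (T y).
  rewrite derive_fiber -derive_comp_linear; congr (derive _ y v).
  by apply/funext => y'; exact: E.
apply: (etrans (congr1 (fun t : R => 0 < t) E2)).
exact: finsler_posdef hF (cinv c x) _ _ (T0 _ y0) (T0 _ v0).
Qed.

End TangentCoordinates.

(** * Invertibility of a positive definite fibre Hessian *)

Section FiberConvexity.
#[local] Set Implicit Arguments.
#[local] Unset Strict Implicit.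
Context {R : realType} {N : nat}.
Local Notation Z := ('rV[R]_N * 'rV[R]_N)%type.

Lemma fund_tensor_unit (F : Z -> R) (D : set Z) (z : Z) : open D ->
  smooth_on D (Fsq F) -> D z ->
  (forall u : 'rV[R]_N, u != 0 ->
    0 < dderiv (dderiv (Fsq F) (0, u)) (0, u) z) ->
  fund_tensor F z \in unitmx.
Proof.
move=> oD sE Dz pos; rewrite unitmxE unitfE; apply/det0P => -[u u0 ug].
(* By definition [hilbert_form (u, u)] is the derivative of [Fsq F] along [(0, u)]; its derivative
   along [(0, u)] is twice the quadratic form of g at [u], which is zero for [u] in the kernel. *)
have := dderiv_hilbert_form oD sE (u, u) (0, u) Dz.
rewrite big1 => [E|a _]; first by have := pos u u0; rewrite E ltxx.
rewrite [X in X + _]big1 => [|b _]; last by rewrite mxE mul0r.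
have /rowP/(_ a) := ug; rewrite !mxE => e.
rewrite add0r (eq_bigr (fun b => 2 * (u 0 b * fund_tensor F z b a))) => [|b _].
  by rewrite -mulr_sumr e !mulr0.
by rewrite mulrCA.
Qed.

End FiberConvexity.

(** * Derivatives of warped terms *)

Section WarpedTerm.
#[local] Set Implicit Arguments.
#[local] Unset Strict Implicit.
Context {R : realType} {V W : normedModType R}.
Variables (D : set V) (S : set W) (l : {linear V -> W}).
Hypothesis cl : continuous l.
Hypothesis oD : open D.
Hypothesis DS : D `<=` l @^-1` S.

Lemma smooth_on_comp_linear (e : W -> R) : smooth_on S e -> smooth_on D (e \o l).
Proof. by move=> se k; exact: Ck_on_sub DS (Ck_on_comp_linear cl (se k)). Qed.

(** The factor [A] is invariant under translation along [w], so the product rule leaves only the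
    derivative of [e]. *)
Lemma dderiv_warped_term (A : V -> R) (e : W -> R) w z :
  smooth_on D A -> smooth_on S e -> (forall h z, A (h *: w + z) = A z) -> D z ->
  dderiv (fun x => A x * e (l x)) w z = A z * dderiv e (l w) (l z).
Proof.
move=> sA se Aw Dz.
have dA := smooth_on_differentiable sA Dz.
have de := smooth_on_differentiable (smooth_on_comp_linear se) Dz.
have A0 : dderiv A w z = 0.
  rewrite dderiv.unlock /derive.
  have -> : (fun h : R => h^-1 *: ((A \o shift z) (h *: w) - A z)) = cst 0.
    by apply/funext => h; rewrite /= Aw subrr scaler0.
  exact: lim_cst.
rewrite (dderivM w dA de) A0 mulr0 addr0; congr (_ * _).
by rewrite dderiv.unlock derive_comp_linear.
Qed.

Lemma dderiv2_warped_term (A : V -> R) (e : W -> R) w z :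
  smooth_on D A -> smooth_on S e -> (forall h z, A (h *: w + z) = A z) -> D z ->
  dderiv (dderiv (fun x => A x * e (l x)) w) w z =
  A z * dderiv (dderiv e (l w)) (l w) (l z).
Proof.
move=> sA se Aw Dz; rewrite -dderiv_warped_term//; last exact: smooth_on_dderiv.
by apply: dderiv_eq_on oD Dz _ => x Dx; rewrite dderiv_warped_term.
Qed.

End WarpedTerm.

Section HalfSquare.
#[local] Set Implicit Arguments.
#[local] Unset Strict Implicit.
Context {R : realType}.

Lemma dderiv2D (V : normedModType R) (U : set V) (f g : V -> R) v z :
  open U -> smooth_on U f -> smooth_on U g -> U z ->
  dderiv (dderiv (fun x => f x + g x) v) v z =
  dderiv (dderiv f v) v z + dderiv (dderiv g v) v z.
Proof.
have D1 f' g' x : smooth_on U f' -> smooth_on U g' -> U x ->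
    dderiv (fun x => f' x + g' x) v x = dderiv f' v x + dderiv g' v x.
  move=> sf sg Ux; rewrite dderiv.unlock.
  by apply: deriveD; [exact: smooth_on_derivable sf Ux|exact: smooth_on_derivable sg Ux].
move=> oU sf sg Uz; rewrite -D1//; [|exact: smooth_on_dderiv..].
by apply: dderiv_eq_on oU Uz _ => x; exact: D1.
Qed.

Context {n : nat} {M : manifold R n} (F : TM M -> R) (c : chart R n M).
Hypothesis hF : finsler F.
Hypothesis ac : atlas c.

Lemma dderiv_half_square_gt0 z (v : 'rV[R]_n) : slit_coord c z -> v != 0 ->
  0 < dderiv (dderiv (half_square F c) (0, v)) (0, v) z.
Proof.
by case: z => x y sz v0; rewrite !dderivE; exact: half_square_posdef.
Qed.

(** Covers zero directions as well, because one of the two parts of a nonzero direction on the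
    product may vanish. *)
Lemma dderiv_half_square_ge0 z (v : 'rV[R]_n) : slit_coord c z ->
  0 <= dderiv (dderiv (half_square F c) (0, v)) (0, v) z.
Proof.
move=> sz; have [->|v0] := eqVneq v 0; last exact/ltW/dderiv_half_square_gt0.
by rewrite [dderiv (dderiv _ _) _]dderivE [(0, 0)](_ : _ = 0)// derive0.
Qed.

End HalfSquare.

(** * The doubly warped metric in induced coordinates *)

Section DoublyWarpedLocal.
#[local] Set Implicit Arguments.
#[local] Unset Strict Implicit.
Context {R : realType} {n1 n2 : nat} {M1 : manifold R n1} {M2 : manifold R n2}.
Variables (F1 : TM M1 -> R) (F2 : TM M2 -> R) (f1 : M1 -> R) (f2 : M2 -> R).
Hypothesis hF1 : finsler F1.
Hypothesis hF2 : finsler F2.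
Hypothesis hf1 : smooth_fun f1.
Hypothesis hf2 : smooth_fun f2.
Hypothesis f1_gt0 : forall p, 0 < f1 p.
Hypothesis f2_gt0 : forall p, 0 < f2 p.
Variables (c1 : chart R n1 M1) (c2 : chart R n2 M2).
Hypothesis ac1 : atlas c1.
Hypothesis ac2 : atlas c2.

Local Notation Z := ('rV[R]_(n1 + n2) * 'rV[R]_(n1 + n2))%type.
Local Notation Z1 := ('rV[R]_n1 * 'rV[R]_n1)%type.
Local Notation Z2 := ('rV[R]_n2 * 'rV[R]_n2)%type.

Definition left_coord (z : Z) : Z1 := (lsubmx z.1, lsubmx z.2).
Definition right_coord (z : Z) : Z2 := (rsubmx z.1, rsubmx z.2).

Lemma left_coord_linear : linear left_coord.
Proof. by move=> k x y; rewrite /left_coord /= !linearP. Qed.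

Lemma right_coord_linear : linear right_coord.
Proof. by move=> k x y; rewrite /right_coord /= !linearP. Qed.

HB.instance Definition _ :=
  GRing.isLinear.Build R Z Z1 _ left_coord left_coord_linear.
HB.instance Definition _ :=
  GRing.isLinear.Build R Z Z2 _ right_coord right_coord_linear.

Lemma left_coord_continuous : continuous left_coord.
Proof.
move=> z.
have h1 : (fun w : Z => lsubmx w.1) @ z --> lsubmx z.1.
  apply: (continuous_comp (g := lsubmx)); [exact: cvg_fst|exact: continuous_lsubmx].
have h2 : (fun w : Z => lsubmx w.2) @ z --> lsubmx z.2.
  apply: (continuous_comp (g := lsubmx)); [exact: cvg_snd|exact: continuous_lsubmx].
exact: (cvg_pair h1 h2).
Qed.

Lemma right_coord_continuous : continuous right_coord.
Proof.
move=> z.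
have h1 : (fun w : Z => rsubmx w.1) @ z --> rsubmx z.1.
  apply: (continuous_comp (g := rsubmx)); [exact: cvg_fst|exact: continuous_rsubmx].
have h2 : (fun w : Z => rsubmx w.2) @ z --> rsubmx z.2.
  apply: (continuous_comp (g := rsubmx)); [exact: cvg_snd|exact: continuous_rsubmx].
exact: (cvg_pair h1 h2).
Qed.

Local Notation D := (dw_coord c1 c2).

Lemma dw_coord_left : D `<=` left_coord @^-1` slit_coord c1.
Proof. by move=> z []. Qed.

Lemma dw_coord_right : D `<=` right_coord @^-1` slit_coord c2.
Proof. by move=> z []. Qed.

Lemma dw_coord_open : open D.
Proof.
have -> : D = left_coord @^-1` slit_coord c1 `&` right_coord @^-1` slit_coord c2.
  by [].
apply: openI.
  exact: (open_comp (fun z _ => @left_coord_continuous z) (slit_coord_open (c := c1))).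
exact: (open_comp (fun z _ => @right_coord_continuous z) (slit_coord_open (c := c2))).
Qed.

Lemma smooth_base (n : nat) (M : manifold R n) (f : M -> R) (c : chart R n M) :
  smooth_fun f -> atlas c ->
  smooth_on (slit_coord c) (fun x => 2 * (f (cinv c x.1) * f (cinv c x.1))).
Proof.
move=> sf ac; have oS := slit_coord_open (c := c).
have sc : smooth_on (slit_coord c) ((f \o cinv c) \o fst).
  apply: (smooth_on_comp_linear (l := fst) (S := cimg c)); last exact: sf.
    by move=> x; exact: cvg_fst.
  by move=> x [].
apply: smooth_onM => //; first exact: smooth_on_cst.
exact: smooth_onM.
Qed.

(** The factor 2 compensates the division by 2 in [half_square]. *)
Definition warp1 (z : Z) : R :=
  2 * (f2 (cinv c2 (right_coord z).1) * f2 (cinv c2 (right_coord z).1)).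
Definition warp2 (z : Z) : R :=
  2 * (f1 (cinv c1 (left_coord z).1) * f1 (cinv c1 (left_coord z).1)).

Lemma Fsq_dw_local : Fsq (dw_local F1 F2 f1 f2 c1 c2) = fun z =>
  warp1 z * half_square F1 c1 (left_coord z)
  + warp2 z * half_square F2 c2 (right_coord z).
Proof.
apply/funext => z; rewrite /Fsq /dw_local /doubly_warped sqr_sqrtr; last first.
  by rewrite addr_ge0// mulr_ge0// sqr_ge0.
by rewrite /warp1 /warp2 /half_square /left_coord /right_coord /=; field.
Qed.

Lemma smooth_warp1 : smooth_on D warp1.
Proof.
exact: (smooth_on_comp_linear right_coord_continuous dw_coord_right
  (smooth_base hf2 ac2)).
Qed.

Lemma smooth_warp2 : smooth_on D warp2.
Proof.
exact: (smooth_on_comp_linear left_coord_continuous dw_coord_left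
  (smooth_base hf1 ac1)).
Qed.

Lemma smooth_Fsq_dw_local : smooth_on D (Fsq (dw_local F1 F2 f1 f2 c1 c2)).
Proof.
have oD := dw_coord_open; rewrite Fsq_dw_local; apply: smooth_onD => //.
  apply: smooth_onM => //; first exact: smooth_warp1.
  exact: (smooth_on_comp_linear left_coord_continuous dw_coord_left
    (smooth_half_square hF1 ac1)).
apply: smooth_onM => //; first exact: smooth_warp2.
exact: (smooth_on_comp_linear right_coord_continuous dw_coord_right
  (smooth_half_square hF2 ac2)).
Qed.

(** The second derivative of F^2 along [(0, u)] is the sum of those of the two half squares along
    the left and right parts of [u], weighted by the positive factors [warp1] and [warp2]; hence it
    is positive. *)
Lemma fund_tensor_dw_local_unit z : D z ->
  fund_tensor (dw_local F1 F2 f1 f2 c1 c2) z \in unitmx.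
Proof.
move=> Dz; have oD := dw_coord_open.
apply: (fund_tensor_unit oD smooth_Fsq_dw_local Dz) => u u0.
have s1 := smooth_half_square hF1 ac1; have s2 := smooth_half_square hF2 ac2.
have cl := left_coord_continuous; have cr := right_coord_continuous.
(* A fibre direction does not move the base point on which the warping factor depends. *)
have w1 h x : warp1 (h *: (0, u) + x) = warp1 x.
  by rewrite /warp1 /right_coord /= scaler0 add0r.
have w2 h x : warp2 (h *: (0, u) + x) = warp2 x.
  by rewrite /warp2 /left_coord /= scaler0 add0r.
have sT1 : smooth_on D (fun x => warp1 x * half_square F1 c1 (left_coord x)).
  apply: smooth_onM => //; first exact: smooth_warp1.
  exact: (smooth_on_comp_linear cl dw_coord_left s1).
have sT2 : smooth_on D (fun x => warp2 x * half_square F2 c2 (right_coord x)).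
  apply: smooth_onM => //; first exact: smooth_warp2.
  exact: (smooth_on_comp_linear cr dw_coord_right s2).
rewrite Fsq_dw_local (dderiv2D _ oD sT1 sT2 Dz).
rewrite (dderiv2_warped_term cl oD dw_coord_left smooth_warp1 s1 w1 Dz).
rewrite (dderiv2_warped_term cr oD dw_coord_right smooth_warp2 s2 w2 Dz).
have l0 : left_coord (0, u) = (0, lsubmx u) by rewrite /left_coord /= linear0.
have r0 : right_coord (0, u) = (0, rsubmx u) by rewrite /right_coord /= linear0.
rewrite /= l0 r0.
have W1 : 0 < warp1 z by rewrite /warp1 !mulr_gt0.
have W2 : 0 < warp2 z by rewrite /warp2 !mulr_gt0.
(* At least one part of [u] is nonzero and contributes a positive term; the other term is
   nonnegative. *)
have [ul|ul] := eqVneq (lsubmx u) 0.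
  have ur : rsubmx u != 0.
    by apply: contra_neq u0 => ur; rewrite -(hsubmxK u) ul ur row_mx0.
  apply: ltr_wpDl.
    apply: mulr_ge0; first exact: ltW.
    exact: dderiv_half_square_ge0 hF1 ac1 _ _ (dw_coord_left Dz).
  apply: mulr_gt0 => //.
  exact: dderiv_half_square_gt0 hF2 ac2 _ _ (dw_coord_right Dz) ur.
apply: ltr_wpDr.
  apply: mulr_ge0; first exact: ltW.
  exact: dderiv_half_square_ge0 hF2 ac2 _ _ (dw_coord_right Dz).
apply: mulr_gt0 => //.
exact: dderiv_half_square_gt0 hF1 ac1 _ _ (dw_coord_left Dz) ul.
Qed.

End DoublyWarpedLocal.

Theorem theorem10 (R : realType) (n1 n2 : nat)
    (M1 : manifold R n1) (M2 : manifold R n2)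
    (F1 : TM M1 -> R) (F2 : TM M2 -> R) (f1 : M1 -> R) (f2 : M2 -> R)
    (hF1 : finsler F1) (hF2 : finsler F2)
    (hf1 : smooth_fun f1) (hf2 : smooth_fun f2)
    (f1_gt0 : forall p, 0 < f1 p) (f2_gt0 : forall p, 0 < f2 p) :
  dw_kahlerian F1 F2 f1 f2 <-> dw_horizontal_integrable F1 F2 f1 f2.
Proof.
have L c1 c2 (a1 : atlas c1) (a2 : atlas c2) := kahlerian_iff_integrable
  (dw_coord_open (c1 := c1) (c2 := c2))
  (smooth_Fsq_dw_local hF1 hF2 hf1 hf2 a1 a2)
  (fund_tensor_dw_local_unit hF1 hF2 hf1 hf2 f1_gt0 f2_gt0 a1 a2).
by split=> H c1 c2 a1 a2; apply/(L c1 c2 a1 a2)/H.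
Qed.
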